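(* Let $\mathcal P$ be a pyramid. Then the following are equivalent: (i) for any $r>0$ and any $0<\kappa<1$, $\operatorname{Cov}(\mathcal P;r,\kappa)<+\infty$; (ii) there exists an extended mm-space $X$ such that $\mathcal P=\mathcal P_X$.
   Context: An mm-space is a triple $(X,d_X,\mu_X)$ where $(X,d_X)$ is a complete separable metric space and $\mu_X$ is a Borel probability measure; $\mathcal X$ is the set of mm-isomorphism classes of mm-spaces. An extended mm-space is the same except that the metric may take values in $[0,+\infty]$. For mm-spaces or extended mm-spaces, $Y\prec X$ means there is a 1-Lipschitz map $f:X\to Y$ with $f_*\mu_X=\mu_Y$. The box distance $\square(X,Y)$ is the infimum of $\max\{\operatorname{dis}(S),1-\pi(S)\}$ over couplings $\pi$ of $\mu_X,\mu_Y$ and Borel $S\subset X\times Y$, with $\operatorname{dis}(S)=\sup\{|d_X(x,x')-d_Y(y,y')|:(x,y),(x',y')\in S\}$. A pyramid is a nonempty subset $\mathcal P\subset\mathcal X$ closed in the box topology, closed downward under $\prec$, and directed with respect to $\prec$. For an (extended) mm-space $X$, $\mathcal P_X=\{Y\in\mathcal X: Y\prec X\}$ (a pyramid). For an mm-space $X$, $r>0$, $0<\kappa<1$: $\operatorname{Cov}(X;r,\kappa)=\min\{\#\mathcal N:\mathcal N\subset X,\ \mu_X(B_r(\mathcal N))\ge1-\kappa\}$, where $B_r(\mathcal N)=\{x: d_X(x,\mathcal N)\le r\}$; for a pyramid, $\operatorname{Cov}(\mathcal P;r,\kappa)=\sup_{X\in\mathcal P}\operatorname{Cov}(X;r,\kappa)$.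 *)

(* Defs.v *)
From HB Require Import structures.
From mathcomp Require Import all_boot all_order all_algebra.
From mathcomp Require Import all_classical all_reals all_analysis.
From mathcomp Require Import Rstruct.
From Stdlib Require Import Rdefinitions.

Set Implicit Arguments.
Unset Strict Implicit.
Unset Printing Implicit Defensive.
Import Order.TTheory GRing.Theory Num.Theory.
Local Open Scope classical_set_scope.
Local Open Scope ring_scope.
Local Open Scope ereal_scope.

Notation RR := Rdefinitions.R.

Record emmspace := EMMSpace {
  emm_disp : measure_display;
  emm_T : measurableType emm_disp;
  emm_d : emm_T -> emm_T -> \bar RR;
  emm_d_ge0 : forall x y, 0 <= emm_d x y;
  emm_d_eq0 : forall x y, emm_d x y = 0 <-> x = y;
  emm_d_sym : forall x y, emm_d x y = emm_d y x;
  emm_d_triangle : forall x y z, emm_d x z <= emm_d x y + emm_d y z;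
  emm_complete : forall u : nat -> emm_T,
      (forall e : RR, (0 < e)%R -> exists N : nat, forall m n : nat,
          leq N m -> leq N n -> emm_d (u m) (u n) < e%:E) ->
      exists l : emm_T, forall e : RR, (0 < e)%R ->
          exists N : nat, forall n : nat, leq N n -> emm_d (u n) l < e%:E;
  emm_separable : exists s : nat -> emm_T,
      forall (x : emm_T) (e : RR), (0 < e)%R -> exists n : nat, emm_d x (s n) < e%:E;
  emm_borel : (@measurable _ emm_T) =
      <<s [set U : set emm_T | forall x, U x ->
             exists e : RR, (0 < e)%R /\ [set y | emm_d x y < e%:E] `<=` U] >>;
  emm_mu : probability emm_T RR
}.

Arguments emm_d {e}.
Arguments emm_mu {e}.

(* mm-spaces: extended mm-spaces with finite distance.  Elements of the
   set of mm-isomorphism classes are represented by their (unique up to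
   mm-isomorphism) full-support representative. *)
Definition full_support (X : emmspace) : Prop :=
  forall (x : emm_T X) (e : RR), (0 < e)%R ->
    0 < (@emm_mu X) [set y | emm_d x y < e%:E].

Definition mm_space (X : emmspace) : Prop :=
  (forall x y : emm_T X, emm_d x y < +oo) /\ full_support X.

Definition dominated (Y X : emmspace) : Prop :=
  exists f : emm_T X -> emm_T Y,
    measurable_fun setT f /\
    (forall x x' : emm_T X, emm_d (f x) (f x') <= emm_d x x') /\
    (forall A : set (emm_T Y), measurable A ->
        (@emm_mu Y) A = (@emm_mu X) (f @^-1` A)).

Definition coupling (X Y : emmspace)
    (pi : probability (emm_T X * emm_T Y)%type RR) : Prop :=
  (forall A : set (emm_T X), measurable A -> pi (A `*` setT) = (@emm_mu X) A) /\
  (forall B : set (emm_T Y), measurable B -> pi (setT `*` B) = (@emm_mu Y) B).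

Definition dis (X Y : emmspace) (S : set (emm_T X * emm_T Y)) : \bar RR :=
  ereal_sup [set z | exists p q, S p /\ S q /\
     z = `| emm_d p.1 q.1 - emm_d p.2 q.2 |].

Definition box (X Y : emmspace) : \bar RR :=
  ereal_inf [set z | exists (pi : probability (emm_T X * emm_T Y)%type RR)
                            (S : set (emm_T X * emm_T Y)),
     coupling pi /\ measurable S /\ z = maxe (dis S) (1 - pi S)].

Definition pyramid (P : emmspace -> Prop) : Prop :=
  (forall X, P X -> mm_space X) /\
  (exists X, P X) /\
  (forall X, mm_space X ->
     (forall e : RR, (0 < e)%R -> exists Y, P Y /\ box X Y < e%:E) -> P X) /\
  (forall X Y, P X -> mm_space Y -> dominated Y X -> P Y) /\
  (forall X X', P X -> P X' ->
     exists Y, P Y /\ dominated X Y /\ dominated X' Y).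

Definition pyramid_of (X : emmspace) : emmspace -> Prop :=
  fun Y => mm_space Y /\ dominated Y X.

Definition Bnbhd (X : emmspace) (r : RR) (N : seq (emm_T X)) : set (emm_T X) :=
  [set x | exists y, List.In y N /\ emm_d x y <= r%:E].

Definition Cov (X : emmspace) (r kappa : RR) : \bar RR :=
  ereal_inf [set z | exists N : seq (emm_T X),
     (1 - kappa)%:E <= (@emm_mu X) (Bnbhd r N) /\ z = (size N)%:R%:E].

Definition CovP (P : emmspace -> Prop) (r kappa : RR) : \bar RR :=
  ereal_sup [set z | exists X, P X /\ z = Cov X r kappa].

(* Main.v *)
From HB Require Import structures.
Require Import Defs.
From mathcomp Require Import all_boot all_order all_algebra.
From mathcomp Require Import all_classical all_reals all_analysis.
From mathcomp Require Import Rstruct lra measurable_realfun.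
Set Implicit Arguments.
Unset Strict Implicit.
Unset Printing Implicit Defensive.
Import Order.TTheory GRing.Theory Num.Theory.

Local Open Scope classical_set_scope.
Local Open Scope ring_scope.

(* Proof idea of the hard direction, (i) implies (ii).

   An increasing sequence X_0 < X_1 < ... in the pyramid has an inverse limit:
   the compatible sequences (x_k) with the extended metric sup_k d_k.  The limit
   measure is obtained by encoding a compatible sequence by countably many bits
   and realising the law of these bits on the Cantor space.  The uniform covering
   bound implies that almost every point of this limit is in the support
   of the measure for the metric sup_k d_k, and then this support is separable.

   Among all these limits choose one, L, maximising every
   energy_q(X) = \int\int min(d, q) (a supremum over the pyramid reached along one
   increasing sequence).  If Y is in the pyramid, the limit L' of an increasing
   sequence that dominates both Y and the sequence defining L dominates L, by a
   compactness argument for 1-Lipschitz measure-preserving maps; as L' cannot have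
   larger energies, L' -> L is an isometry, so L dominates L', hence Y.

   Conversely let Y < L.  Restricted to a finite net of L, the metrics d_n increase
   to a metric that is at least d_Y.  Adding to X_n shortcuts between the
   points of the net, of length d_Y + epsilon, gives an mm-space dominated by X_n
   and box-close to Y; so Y belongs to the pyramid, which is closed. *)

(** * Probability and extended mm-spaces *)

(** With the metric $\sup_k d_k$, the set of all compatible sequences need not be separable and its
    balls may be null. The covering bound enters exactly here. If every $X_n$ has a net of at most
    $K$ balls carrying mass $1-\kappa$, dropping the centres whose ball has mass below
    $\kappa/(K+1)$ costs at most $\kappa$. So most points of each $X_n$ have a ball whose mass is
    bounded below independently of $n$, and a limsup over $n$ carries this bound to the limit.
    Domination provides maps $L'\to X_n$ separately for each $n$, and nothing makes them compatible.
    Limits along one ultrafilter at all levels do. Energies are truncated because distances may be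
    infinite. All $q$ are used because a cut at $q$ does not see a shortening that happens above
    $q$. A finite net is used for $Y\prec L$ because $d_n$ need not converge uniformly. The
    $\varepsilon$ in a shortcut keeps its length positive, so that nothing changes at small scales,
    and absorbs the defect of $d_Y\le d_n+\varepsilon$ on the net. *)

Section law.
Context d d' (T : measurableType d) (T' : measurableType d') (R : realType).

Lemma law_exists (P : probability T R) (f : T -> T') :
  measurable_fun setT f ->
  exists Q : probability T' R, forall A, Q A = P (f @^-1` A).
Proof.
move=> mf; have mf' : f \in mfun by exact: mem_set.
by exists (distribution P (mfun_Sub mf')) => A.
Qed.

End law.

Lemma probability_unique d (T : measurableType d) (R : realType)
    (G : set (set T)) (m1 m2 : probability T R) :
  @measurable _ T = <<s G >> -> setI_closed G ->
  (forall A, G A -> m1 A = m2 A) ->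
  forall A, measurable A -> m1 A = m2 A.
Proof.
move=> mG GI m12.
(* [setT] joins the generators because uniqueness of measures asks for a cover of the space by
   generators of finite mass. *)
have mGT : @measurable _ T = <<s G `|` [set setT] >>.
  rewrite mG; apply/seteqP; split.
    by apply: sub_sigma_algebra2 => A GA; left.
  apply: smallest_sub; first exact: smallest_sigma_algebra.
  move=> A [GA|->]; first exact: sub_sigma_algebra.
  by rewrite -mG; exact: measurableT.
apply: (measure_unique (G `|` [set setT]) (fun=> setT)) => //.
- move=> A B [GA|->] [GB|->]; rewrite ?setIT ?setTI; [left; exact: GI|left|left|right] => //.
- by move=> _; right.
- by rewrite bigcup_const//; exists 0%N.
- move=> A [/m12//|->] /=; transitivity (1 : \bar R)%E; first exact: probability_setT.
  exact/esym/probability_setT.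
- by move=> _ /=; rewrite (_ : m1 setT = 1%E) ?ltry//; exact: probability_setT.
Qed.

Section continuity_of_measure.
Context d (T : measurableType d) (R : realType) (P : probability T R).

Lemma measure_bigcup_gt (F : nat -> set T) (a : \bar R) :
  (forall n, measurable (F n)) -> (forall n m, (n <= m)%N -> F n `<=` F m) ->
  (a < P (\bigcup_n F n))%E -> exists n, (a < P (F n))%E.
Proof.
move=> mF ndF; apply: contraPP => /forallNP h; apply/negP; rewrite -leNgt.
have hF : {homo F : n m / (n <= m)%N >-> (n <= m)%O}.
  by move=> n m nm; apply/subsetPset; exact: ndF.
have c := nondecreasing_cvg_mu (mu := P) mF (bigcup_measurable (fun k _ => mF k)) hF.
rewrite -(cvg_lim _ c)//; apply: lime_le; first by apply/cvg_ex; eexists; exact: c.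
by near=> n => /=; rewrite leNgt; apply/negP.
Unshelve. all: by end_near. Qed.

Lemma measure_bigcap_ge (F : nat -> set T) (a : \bar R) :
  (forall n, measurable (F n)) -> (forall n m, (n <= m)%N -> F m `<=` F n) ->
  (forall n, (a <= P (F n))%E) -> (a <= P (\bigcap_n F n))%E.
Proof.
move=> mF ndF h.
have hF : {homo F : n m / (n <= m)%N >-> (m <= n)%O}.
  by move=> n m nm; apply/subsetPset; exact: ndF.
have P0 : (P (F 0%N) < +oo)%E by apply: (le_lt_trans (probability_le1 P (mF _))); rewrite ltry.
have c := nonincreasing_cvg_mu P0 mF (bigcapT_measurable mF) hF.
rewrite -(cvg_lim _ c)//; apply: lime_ge; first by apply/cvg_ex; eexists; exact: c.
by near=> n => /=; exact: h.
Unshelve. all: by end_near. Qed.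

End continuity_of_measure.

(* In [emmspace] and [pyramid] the conditions [(0 < e)%R] are Stdlib's [Rlt]. *)
Lemma R0ltE (e : RR) :
  Rdefinitions.Rlt (Rdefinitions.IZR BinNums.Z0) e <-> 0 < e.
Proof. by split => /RltP. Qed.

Lemma invS_lt (e : RR) : 0 < e -> exists j : nat, (j.+1%:R)^-1 < e.
Proof.
by move=> e0; have [j je] := ltr_add_invr e0; exists j; move: je; rewrite add0r.
Qed.

(** * Topology and nets of an extended mm-space *)

Section emm_basics.
Variable X : emmspace.
Implicit Types (x y z : emm_T X) (U : set (emm_T X)).

Definition cball x (r : RR) : set (emm_T X) := [set y | (emm_d x y <= r%:E)%E].

Definition mopen U := forall x, U x ->
  exists e : RR, 0 < e /\ [set y | emm_d x y < e%:E]%E `<=` U.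

Lemma emm_dxx x : emm_d x x = 0%E.
Proof. exact/emm_d_eq0. Qed.

Lemma emm_tri x y z (a b : RR) :
  (emm_d x y <= a%:E)%E -> (emm_d y z <= b%:E)%E -> (emm_d x z <= (a + b)%:E)%E.
Proof.
by move=> xy yz; apply: (le_trans (emm_d_triangle x y z)); rewrite EFinD; exact: leeD.
Qed.

Lemma emm_tri_lt x y z (a b : RR) :
  (emm_d x y <= a%:E)%E -> (emm_d y z < b%:E)%E -> (emm_d x z < (a + b)%:E)%E.
Proof.
move=> xy yz; apply: (le_lt_trans (emm_d_triangle x y z)); rewrite EFinD.
apply: lee_ltD => //; rewrite fin_numE -ltNye -ltey.
by rewrite (lt_le_trans _ (emm_d_ge0 _ _))//= (le_lt_trans xy) ?ltry.
Qed.

Lemma emm_d_symle x y (a : \bar RR) : (emm_d x y <= a)%E -> (emm_d y x <= a)%E.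
Proof. by rewrite emm_d_sym. Qed.

Lemma emm_eq x y : (forall e : RR, 0 < e -> (emm_d x y <= e%:E)%E) -> x = y.
Proof.
move=> h; apply/emm_d_eq0/eqP; rewrite eq_le emm_d_ge0 andbT.
by apply/lee_addgt0Pr => e /h; rewrite add0e.
Qed.

Lemma mopen_measurable U : mopen U -> measurable U.
Proof.
move=> oU; rewrite emm_borel; apply: sub_sigma_algebra => x /oU[e [e0 eU]].
by exists e; split => //; exact/R0ltE.
Qed.

Lemma emm_d_fin x y : (emm_d x y < +oo)%E ->
  exists2 a : RR, 0 <= a & emm_d x y = a%:E.
Proof.
have := emm_d_ge0 x y; case: (emm_d x y) => [a| |]//; rewrite lee_fin => a0 _.
by exists a.
Qed.

Lemma mopen_ball x (r : RR) : mopen [set y | emm_d x y < r%:E]%E.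
Proof.
move=> y /= xy; have [a a0 E] := emm_d_fin (lt_trans xy (ltry r)).
move: xy; rewrite E lte_fin => ar; exists (r - a); split; first by rewrite subr_gt0.
move=> z /= yz; rewrite [r](_ : _ = a + (r - a)); last by lra.
by apply: emm_tri_lt yz; rewrite E.
Qed.

Lemma measurable_ball x (r : RR) : measurable [set y | emm_d x y < r%:E]%E.
Proof. exact/mopen_measurable/mopen_ball. Qed.

Lemma measurable_emm_d x : measurable_fun setT (emm_d x).
Proof.
apply: (measurability _ (ErealGenInftyO.measurableE RR)).
move=> _ [_ [r ->] <-]; rewrite setTI.
rewrite [X in measurable X](_ : _ = [set y | emm_d x y < r%:E]%E).
  exact: measurable_ball.
by apply/seteqP; split => y /=; rewrite in_itv.
Qed.

Lemma measurable_cball x (r : RR) : measurable (cball x r).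
Proof.
by rewrite -[cball x r]setTI; exact: emeasurable_fun_infty_c (measurable_emm_d x) _.
Qed.

(** Second countability, with dense centres and radii $1/(j+1)$. Measurability thus reduces to
    closed balls. These are the right test sets, since a closed ball for a supremum of metrics is an
    intersection of closed balls. *)
Lemma mopen_bigcup_cball U : mopen U ->
  exists (c : nat -> emm_T X) (r : nat -> RR) (A : set nat),
    U = \bigcup_(i in A) cball (c i) (r i).
Proof.
move=> oU; have [s sP] := emm_separable X.
pose c n := s (odflt (0%N, 0%N) (unpickle n)).1.
pose r n : RR := ((odflt (0%N, 0%N) (unpickle n)).2.+1%:R)^-1.
exists c, r, [set n | cball (c n) (r n) `<=` U].
apply/seteqP; split=> [x Ux|x [n /= nU /nU//]].
have [e [e0 eU]] := oU x Ux.
have [j je] : exists j : nat, (j.+1%:R)^-1 < e / 2 :> RR.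
  by apply: invS_lt; lra.
have j0 : 0 < (j.+1%:R)^-1 :> RR by rewrite invr_gt0.
have [n xn] := sP x _ (iffRL (R0ltE _) j0).
exists (pickle (n, j)); rewrite /= /c /r pickleK /=; last first.
  by apply/emm_d_symle/ltW.
move=> y /= ny; apply: eU => /=.
have := emm_tri (ltW xn) ny => /le_lt_trans; apply; rewrite lte_fin.
by move: je; set i := _^-1; lra.
Qed.

Lemma emm_completeP (u : nat -> emm_T X) :
  (forall e : RR, 0 < e -> exists N : nat, forall m n : nat,
     (N <= m)%N -> (N <= n)%N -> (emm_d (u m) (u n) <= e%:E)%E) ->
  exists l, forall e : RR, 0 < e ->
    exists N : nat, forall n : nat, (N <= n)%N -> (emm_d (u n) l <= e%:E)%E.
Proof.
move=> cu; have [e /R0ltE e0|l lP] := @emm_complete X u.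
  have [|N NP] := cu (e / 2); first by lra.
  by exists N => m n /NP h /h /le_lt_trans; apply; rewrite lte_fin; lra.
exists l => e /R0ltE/lP [N NP]; exists N => n /NP; exact: ltW.
Qed.

Lemma emm_separableP : exists s : nat -> emm_T X,
  forall x (e : RR), 0 < e -> exists n, (emm_d x (s n) < e%:E)%E.
Proof. by have [s sP] := emm_separable X; exists s => x e /R0ltE; exact: sP. Qed.

Lemma Bnbhd_cons (r : RR) x (N : seq (emm_T X)) :
  Bnbhd r (x :: N) = cball x r `|` Bnbhd r N.
Proof.
apply/seteqP; split => [y [z /= [[<-|zN] yz]]|y [xy|[z [zN yz]]]].
- by left; exact: emm_d_symle.
- by right; exists z.
- by exists x; split; [left|exact: emm_d_symle].
- by exists z; split => //; right.
Qed.

Lemma measurable_Bnbhd (r : RR) (N : seq (emm_T X)) : measurable (Bnbhd r N).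
Proof.
elim: N => [|x N IH]; last first.
  by rewrite Bnbhd_cons; apply: measurableU => //; exact: measurable_cball.
by rewrite (_ : Bnbhd _ _ = set0)// -subset0 => x [y []].
Qed.

(** The balls around a dense sequence exhaust the space, so finitely many of them suffice by
    continuity from below. Infinite distances do no harm. *)
Lemma emm_net (r k : RR) : 0 < r -> 0 < k ->
  exists N : seq (emm_T X), ((1 - k)%:E <= emm_mu (Bnbhd r N))%E.
Proof.
move=> r0 k0; have [s sP] := emm_separableP.
have inN n m : (n < m)%N -> List.In (s n) [seq s i | i <- iota 0 m].
  elim: m => // m IH; rewrite ltnS leq_eqVlt => h.
  rewrite -[m.+1]addn1 iotaD map_cat; apply/List.in_or_app.
  by case/orP: h => [/eqP ->|/IH]; [right; left|left].
pose F m := Bnbhd r [seq s i | i <- iota 0 m].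
have [|||n /ltW h] := @measure_bigcup_gt _ _ _ (@emm_mu X) F (1 - k)%:E.
- by move=> n; exact: measurable_Bnbhd.
- move=> n m nm x [y [yN xy]]; exists y; split => //.
  by rewrite -(subnKC nm) iotaD map_cat; apply/List.in_or_app; left.
- rewrite (_ : \bigcup_n F n = setT) ?probability_setT ?lte_fin; first by lra.
  apply/seteqP; split => // x _; have [n xn] := sP x r r0.
  by exists n.+1 => //; exists (s n); split; [exact: inN|exact: ltW].
by exists [seq s i | i <- iota 0 n].
Qed.

End emm_basics.

Lemma full_supportP X : full_support X <->
  forall (x : emm_T X) (e : RR), 0 < e -> (0 < emm_mu (cball x e))%E.
Proof.
split=> h x e.
  move=> /R0ltE/(h x)/lt_le_trans; apply; apply: le_measure; rewrite ?inE.
  - exact: measurable_ball.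
  - exact: measurable_cball.
  - by move=> y; exact: ltW.
move=> /R0ltE e0; have e20 : 0 < e / 2 by lra.
apply: (lt_le_trans (h x _ e20)); apply: le_measure; rewrite ?inE.
- exact: measurable_cball.
- exact: measurable_ball.
- by move=> y /= /le_lt_trans; apply; rewrite lte_fin; lra.
Qed.

Section lipschitz.
Variables X Y : emmspace.
Implicit Types f : emm_T X -> emm_T Y.

Lemma cball_measurable_fun d (T : measurableType d) (q : T -> emm_T X) :
  (forall x (r : RR), measurable (q @^-1` cball x r)) -> measurable_fun setT q.
Proof.
move=> mq; apply: (measurability _ (emm_borel X)) => _ [U oU <-]; rewrite setTI.
have [|c [r [A ->]]] := @mopen_bigcup_cball X U.
  by move=> x /oU [e [/R0ltE e0 h]]; exists e.
by rewrite preimage_bigcup; apply: bigcup_measurable => k _; exact: mq.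
Qed.

Definition lip f := forall x x', (emm_d (f x) (f x') <= emm_d x x')%E.

Lemma lip_measurable f : lip f -> measurable_fun setT f.
Proof.
move=> fl; apply: (measurability _ (emm_borel Y)) => _ [U oU <-]; rewrite setTI.
apply: mopen_measurable => x /oU[e [/R0ltE e0 eU]]; exists e; split => // y /= xy.
by apply: eU => /=; apply: le_lt_trans xy; exact: fl.
Qed.

Definition mpres f := forall A, measurable A -> emm_mu A = emm_mu (f @^-1` A).

End lipschitz.

Lemma dominatedP Y X : dominated Y X <->
  exists f : emm_T X -> emm_T Y, lip f /\ mpres f.
Proof.
split=> [[f [_ []]]|[f [fl fm]]]; first by exists f.
by exists f; split => //; exact: lip_measurable.
Qed.

Lemma lip_comp X Y Z (g : emm_T Y -> emm_T Z) (f : emm_T X -> emm_T Y) :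
  lip g -> lip f -> lip (g \o f).
Proof. by move=> gl fl x y; exact: le_trans (gl _ _) (fl _ _). Qed.

Lemma mpres_comp X Y Z (g : emm_T Y -> emm_T Z) (f : emm_T X -> emm_T Y) :
  lip g -> mpres g -> mpres f -> mpres (g \o f).
Proof.
move=> gl gm fm A mA; rewrite gm// fm//.
by rewrite -[X in measurable X]setTI; exact: lip_measurable.
Qed.

Lemma dominated_trans X Y Z : dominated X Y -> dominated Y Z -> dominated X Z.
Proof.
move=> /dominatedP[f [fl fm]] /dominatedP[g [gl gm]]; apply/dominatedP.
by exists (f \o g); split; [exact: lip_comp|exact: mpres_comp].
Qed.

(** A 1-Lipschitz measure-preserving map sends a net of [X] to a net of [Y] with the same number of
    points. This is all that (ii) implies (i) requires. *)
Lemma Cov_dominated_bound X (r k : RR) : 0 < r -> 0 < k ->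
  exists K : nat, forall Y, dominated Y X -> (Cov Y r k <= K%:R%:E)%E.
Proof.
move=> r0 k0; have [N NP] := emm_net X r0 k0.
exists (size N) => Y /dominatedP[f [fl fm]].
apply: ereal_inf_lbound; exists (map f N); split; last by rewrite size_map.
apply: (le_trans NP); rewrite fm; last exact: measurable_Bnbhd.
apply: le_measure; rewrite ?inE; first exact: measurable_Bnbhd.
  by rewrite -[X in measurable X]setTI; apply: lip_measurable => //; exact: measurable_Bnbhd.
move=> x [y [yN xy]]; exists (f y); split; first exact: List.in_map.
exact: le_trans (fl _ _) xy.
Qed.

Lemma CovP_finite_of_pyramid_of (P : emmspace -> Prop) X :
  (forall Y, P Y -> dominated Y X) ->
  forall r k : RR, 0 < r -> 0 < k -> (CovP P r k < +oo)%E.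
Proof.
move=> PX r k r0 k0; have [K KP] := Cov_dominated_bound X r0 k0.
apply: (@le_lt_trans _ _ K%:R%:E); last exact: ltry.
by apply: ge_ereal_sup => _ [Y [PY ->]]; apply: KP; exact: PX.
Qed.

Lemma CovP_net (P : emmspace -> Prop) (r k : RR) : (CovP P r k < +oo)%E ->
  exists K : nat, forall X, P X -> exists N : seq (emm_T X),
    (size N <= K)%N /\ ((1 - k)%:E <= emm_mu (Bnbhd r N))%E.
Proof.
move=> cP.
have [K KP] : exists K : nat, (CovP P r k < K%:R%:E)%E.
  case: (CovP P r k) cP => [a _| |]; [|by []|by exists 0%N; exact: ltNyr].
  exists (Num.bound `|a|); rewrite lte_fin.
  by apply: le_lt_trans (ler_norm _) _; apply: archi_boundP; exact: normr_ge0.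
exists K => X PX.
have : (Cov X r k < K%:R%:E)%E.
  by apply: le_lt_trans KP; apply: ereal_sup_ubound; exists X.
move=> /ereal_inf_lt[_ [N [NP ->]]]; rewrite lte_fin ltr_nat => /ltnW NK.
by exists N.
Qed.

(** * Compactness of 1-Lipschitz measure-preserving maps *)

Lemma measure_le_off d (T : measurableType d) (R : realType)
    (P : probability T R) (A A' B : set T) (e : R) :
  measurable A -> measurable A' -> measurable B ->
  ((1 - e)%:E <= P B)%E -> A `&` B `<=` A' -> (P A <= P A' + e%:E)%E.
Proof.
move=> mA mA' mB PB AB.
apply: (@le_trans _ _ (P (A' `|` ~` B))%E).
  apply: le_measure; rewrite ?inE//; first by apply: measurableU => //; exact: measurableC.
  by move=> x Ax; have [Bx|Bx] := pselect (B x); [left; exact: AB|right].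
have mCB := measurableC mB.
apply: (le_trans (measureU2 P mA' mCB)); apply: leeD => //.
suff : (P (~` B) <= e%:E)%E by [].
rewrite probability_setC//; move: PB (probability_le1 P mB).
rewrite -[P B]fineK ?fin_num_measure// -EFinB !lee_fin => h _; lra.
Qed.

(** * Comparison of nearby laws on open sets *)

Section close_laws.
Variable X : emmspace.
Implicit Types (U : set (emm_T X)).

(** The points whose distance to the complement of [U] exceeds [e]. The slack between [e] and [e']
    makes this set open. *)
Definition mshrink U (e : RR) : set (emm_T X) :=
  [set x | exists e' : RR, e < e' /\ [set y | emm_d x y < e'%:E]%E `<=` U].

Lemma mopen_mshrink U (e : RR) : mopen (mshrink U e).
Proof.
move=> x [e' [ee' xU]]; exists ((e' - e) / 2); split; first by lra.
move=> y /= xy; exists ((e' + e) / 2); split; first by lra.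
move=> z /= yz; apply: xU => /=; have := emm_tri_lt (ltW xy) yz => /lt_le_trans.
by apply; rewrite lee_fin; lra.
Qed.

Lemma mshrink_bigcup U : mopen U -> \bigcup_n mshrink U (n.+1%:R^-1) = U.
Proof.
move=> oU; apply/seteqP; split => [x [n _ [e [ne xU]]]|x Ux].
  apply: xU => /=; rewrite emm_dxx lte_fin; apply: lt_trans ne.
  by rewrite invr_gt0.
have [e [e0 eU]] := oU x Ux; have [j je] := invS_lt e0.
by exists j => //; exists e.
Qed.

Lemma mshrink_le U (a b : RR) : a <= b -> mshrink U b `<=` mshrink U a.
Proof. by move=> ab x [e [be eU]]; exists e; split => //; exact: le_lt_trans be. Qed.

(** One half of the fact that the Prokhorov distance separates laws: the shrunk sets increase to
    [U]. *)
Lemma measure_le_of_mshrink (m1 m2 : probability (emm_T X) RR) :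
  (forall (e : RR) U, 0 < e -> mopen U -> (m1 (mshrink U e) <= m2 U + e%:E)%E) ->
  forall U, mopen U -> (m1 U <= m2 U)%E.
Proof.
move=> H U oU; apply/lee_addgt0Pr => e e0; rewrite leNgt; apply/negP.
rewrite -{2}(mshrink_bigcup oU) => /measure_bigcup_gt [||n].
- by move=> n; exact/mopen_measurable/mopen_mshrink.
- by move=> n m nm; apply: mshrink_le; rewrite lef_pV2 ?posrE// ler_nat.
apply/negP; rewrite -leNgt.
(* In [H] one number is both the shrinking radius and the error, so it has to be small for both
   purposes. *)
pose e' := Num.min e n.+1%:R^-1.
have e'0 : 0 < e' by rewrite lt_min e0 invr_gt0 ltr0n.
apply: (@le_trans _ _ (m1 (mshrink U e'))).
  apply: le_measure; rewrite ?inE; try exact/mopen_measurable/mopen_mshrink.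
  by apply: mshrink_le; rewrite ge_min lexx orbT.
apply: (le_trans (H _ _ e'0 oU)); apply: leeD => //.
by rewrite lee_fin ge_min lexx.
Qed.

Lemma emm_measure_unique (m1 m2 : probability (emm_T X) RR) :
  (forall U, mopen U -> m1 U = m2 U) ->
  forall A, measurable A -> m1 A = m2 A.
Proof.
move=> H; apply: (probability_unique (emm_borel X)).
  move=> U V oU oV x [/oU[e [/R0ltE e0 eU]] /oV[e' [/R0ltE e'0 e'V]]].
  exists (Num.min e e'); split; first by apply/R0ltE; rewrite lt_min e0.
  move=> y /= xy; split; [apply: eU|apply: e'V] => /=; apply: (lt_le_trans xy);
  by rewrite lee_fin ge_min lexx ?orbT.
by move=> U oU; apply: H => x /oU [e [/R0ltE e0 eU]]; exists e.
Qed.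

End close_laws.

(** Maps that are [e]-close outside a set of mass [e] have laws that are [e]-close in the sense of
    Prokhorov. Here the law of [g] is [emm_mu] for every [e], so the law of [h] is [emm_mu] as
    well. *)
Lemma mpres_close W X (h : emm_T W -> emm_T X) : lip h ->
  (forall e : RR, 0 < e -> exists g : emm_T W -> emm_T X,
     [/\ lip g, mpres g & exists B, [/\ measurable B, ((1 - e)%:E <= emm_mu B)%E &
        forall w, B w -> (emm_d (g w) (h w) <= e%:E)%E]]) ->
  mpres h.
Proof.
move=> hl H; have [Q QE] := law_exists (@emm_mu W) (lip_measurable hl).
have mpre (k : emm_T W -> emm_T X) U : lip k -> mopen U -> measurable (k @^-1` U).
  move=> kl /mopen_measurable mU; rewrite -[X in measurable X]setTI.
  exact: lip_measurable.
suff : forall U : set (emm_T X), mopen U -> emm_mu U = Q U.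
  by move=> /emm_measure_unique E A mA; rewrite E.
move=> U oU; apply/eqP; rewrite eq_le; apply/andP; split.
- apply: measure_le_of_mshrink oU => e V e0 oV.
  have [g [gl gm [B [mB PB Bc]]]] := H e e0.
  rewrite QE gm; last exact/mopen_measurable/mopen_mshrink.
  apply: (measure_le_off _ _ mB PB); try by apply: mpre => //; exact: mopen_mshrink.
  move=> w [[e' [ee' eV]] /Bc wc]; apply: eV => /=.
  exact: le_lt_trans wc _.
- apply: measure_le_of_mshrink oU => e V e0 oV.
  have [g [gl gm [B [mB PB Bc]]]] := H e e0.
  rewrite QE gm; last exact: mopen_measurable.
  apply: (measure_le_off _ _ mB PB); try by apply: mpre => //; exact: mopen_mshrink.
  move=> w [[e' [ee' eV]] /Bc wc]; apply: eV => /=.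
  by rewrite emm_d_sym; exact: le_lt_trans wc _.
Qed.

Lemma ultra_meet (U : set_system nat) (A B : set nat) :
  UltraFilter U -> U A -> U B -> exists n, A n /\ B n.
Proof.
move=> UU UA UB; have UF : ProperFilter U by exact: ultra_proper.
by have [n] := @filter_ex _ _ UF _ (filterI UA UB); exists n.
Qed.

(** * Limits of maps along an ultrafilter *)

Section ultralimits.
Variables (W X : emmspace) (U : set_system nat).
Hypotheses (UU : UltraFilter U) (Wsupp : full_support W).
Variable g : nat -> emm_T W -> emm_T X.
Hypothesis Ug : U [set n | lip (g n) /\ mpres (g n)].

Lemma ultra_pigeonhole T (N : seq T) (B : T -> set nat) :
  U [set n | exists y, List.In y N /\ B y n] -> exists y, U (B y).
Proof.
elim: N => [|a N IH] /= UN.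
  have : U set0 by apply: filterS UN => n [y []].
  by move=> /filter_ex[].
have [|na] := in_ultra_setVsetC (B a) UU; first by exists a.
apply: IH; apply: filterS (filterI na UN) => n [nB [y [[<-//|yN] By]]].
by exists y.
Qed.

Lemma filter_list T (N : seq T) (B : T -> set nat) :
  (forall y, U (B y)) -> U [set n | forall y, List.In y N -> B y n].
Proof.
move=> UB; elim: N => [|a N IH]; first by apply: filterE => n y [].
apply: filterS (filterI (UB a) IH) => n [Ba BN] y /= [<-//|]; exact: BN.
Qed.

(** Full support supplies the compactness. The ball around [w] has mass [dl > 0], so under [g n] it
    cannot miss a finite net of [X] whose complement has mass at most [dl / 2]. Thus [g n w] is near
    one of finitely many points, and the ultrafilter selects one of them. *)
Lemma ultralimit_net (w : emm_T W) (r : RR) : 0 < r ->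
  exists y, U [set n | (emm_d (g n w) y <= r%:E)%E].
Proof.
move=> r0; have r20 : 0 < r / 2 by lra.
have := (iffLR (full_supportP W) Wsupp) w _ r20.
have mwr := measurable_cball w (r / 2).
have := fin_num_measure (@emm_mu W) _ mwr.
move=> /fineK <-; rewrite lte_fin; set dl := fine _ => dl0.
have [|N NP] := @emm_net X (r / 2) (dl / 2) r20; first by lra.
apply: (@ultra_pigeonhole _ N (fun y => [set n | (emm_d (g n w) y <= r%:E)%E])).
apply: filterS Ug => n [gl gm] /=.
have mN := measurable_Bnbhd (r / 2) N.
have [w' [/= ww' [y [yN w'y]]]] : cball w (r / 2) `&` (g n @^-1` Bnbhd (r / 2) N) !=set0.
  apply/set0P/negP => /eqP E0.
  have := @measure_le_off _ _ _ (@emm_mu W) (cball w (r / 2)) set0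
    (g n @^-1` Bnbhd (r / 2) N) (dl / 2) mwr measurable0.
  rewrite -gm// E0 measure0 add0e => /(_ _ NP (@subset_refl _ _)).
  rewrite -[emm_mu _]fineK ?fin_num_measure// lee_fin -/dl => h.
  have := h (_ : measurable _); rewrite -[X in measurable X]setTI.
  move=> /(_ (lip_measurable gl measurableT mN)).
  lra.
exists y; split => //; rewrite [r](_ : _ = r / 2 + r / 2); last by lra.
by apply: emm_tri w'y; exact: le_trans (gl _ _) ww'.
Qed.

(** The approximations [y j] at scales $1/(j+1)$ form a Cauchy sequence: two sets of the ultrafilter
    share an index [i], and [g i w] is close to both points. *)
Lemma ultralimit_exists (w : emm_T W) :
  exists l, forall e : RR, 0 < e -> U [set n | (emm_d (g n w) l <= e%:E)%E].
Proof.
have pos j : 0 < j.+1%:R^-1 :> RR by rewrite invr_gt0.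
have [y yP] := choice (fun j => ultralimit_net w (pos j)).
have [e e0|l lP] := @emm_completeP X y.
  have [|j je] := @invS_lt (e / 2); first by lra.
  exists j => m n jm jn; have [i /= [im in_]] := ultra_meet UU (yP m) (yP n).
  apply: (le_trans (emm_tri (emm_d_symle im) in_)); rewrite lee_fin.
  have hm : m.+1%:R^-1 <= j.+1%:R^-1 :> RR by rewrite lef_pV2 ?posrE// ler_nat.
  have hn : n.+1%:R^-1 <= j.+1%:R^-1 :> RR by rewrite lef_pV2 ?posrE// ler_nat.
  move: hm hn je; set a := _^-1; set b := _^-1; set c := _^-1; lra.
exists l => e e0; have [|N NP] := lP (e / 2); first by lra.
have [|j je] := @invS_lt (e / 2); first by lra.
apply: filterS (yP (maxn N j)) => n /= h.
apply: (le_trans (emm_tri h (NP _ (leq_maxl _ _)))); rewrite lee_fin.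
have hm : (maxn N j).+1%:R^-1 <= j.+1%:R^-1 :> RR by rewrite lef_pV2 ?posrE// ler_nat ltnS leq_maxr.
move: hm je; set a := _^-1; set c := j.+1%:R^-1; lra.
Qed.

Lemma ultralimit_lip_mpres : exists h : emm_T W -> emm_T X,
  [/\ lip h, mpres h &
      forall w (e : RR), 0 < e -> U [set n | (emm_d (g n w) (h w) <= e%:E)%E]].
Proof.
have [h hP] := choice ultralimit_exists; exists h.
have hl : lip h.
  move=> w w'; have [ww'|] := boolP (emm_d w w' < +oo)%E; last first.
    by rewrite -leNgt leye_eq => /eqP ->; exact: leey.
  have [a a0 E] := emm_d_fin ww'; rewrite E; apply/lee_addgt0Pr => e e0.
  have e20 : 0 < e / 2 by lra.
  have [n /= [[[gl _] nw] nw']] := ultra_meet UU (filterI Ug (hP w _ e20)) (hP w' _ e20).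
  have gww' : (emm_d (g n w) (g n w') <= a%:E)%E by rewrite -E.
  apply: (le_trans (emm_tri (emm_tri (emm_d_symle nw) gww') nw')).
  by rewrite -EFinD lee_fin; lra.
split => //; apply: mpres_close => // e e0.
have e30 : 0 < e / 3 by lra.
have [N NP] := emm_net W e30 e0.
(* A single index serves every point of the finite net. The Lipschitz bounds for [g n] and [h]
   extend the closeness to the neighbourhood of the net, whence the three thirds of [e]. *)
have [n /= [[gl gm] nN]] := ultra_meet UU Ug (@filter_list _ N _ (fun w => hP w _ e30)).
exists (g n); split => //; exists (Bnbhd (e / 3) N); split => //.
  exact: measurable_Bnbhd.
move=> w [y [yN wy]].
have h1 : (emm_d (g n w) (g n y) <= (e / 3)%:E)%E by exact: le_trans (gl _ _) wy.
have h2 : (emm_d (h y) (h w) <= (e / 3)%:E)%E by apply: le_trans (hl _ _) _; rewrite emm_d_sym.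
apply: (le_trans (emm_tri (emm_tri h1 (nN _ yN)) h2)).
by rewrite lee_fin; lra.
Qed.

End ultralimits.

(** * Projections in an inverse system, and limits of non-compatible maps *)

Section threads.
Variables (X : nat -> emmspace) (f : forall k, emm_T (X k.+1) -> emm_T (X k)).
Hypotheses (fl : forall k, lip (@f k)) (fm : forall k, mpres (@f k)).

(** The images of [x] at all lower levels are packed into one dependent sequence. Composite maps
    from level [n] to level [k] would require transport along equalities of indices. *)
Lemma thread_exists n (x : emm_T (X n)) : exists y : forall k, emm_T (X k),
  y n = x /\ forall k, (k < n)%N -> f (y k.+1) = y k.
Proof.
elim: n x => [x|n IH x].
  exists (@dfwith nat (fun k => emm_T (X k)) (fun k => point) 0%N x).
  by split => //; rewrite dfwithin.
have [y [yn yP]] := IH (f x); exists (@dfwith nat (fun k => emm_T (X k)) y n.+1 x).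
split; first by rewrite dfwithin.
move=> k; rewrite ltnS leq_eqVlt => /orP[/eqP ->|kn].
  by rewrite dfwithin dfwithout ?yn// gtn_eqF.
by rewrite !dfwithout ?yP// gtn_eqF// ?ltnS// ltnW.
Qed.

(* The values [thread x k] with [n < k] are arbitrary. *)
Definition thread n x := projT1 (cid (@thread_exists n x)).

Lemma thread_top n x : @thread n x n = x.
Proof. by rewrite /thread; case: cid => y []. Qed.

Lemma thread_step n x k : (k < n)%N -> f (@thread n x k.+1) = @thread n x k.
Proof. by rewrite /thread; case: cid => y [_ /= h]; exact: h. Qed.

Lemma thread_lip_mpres n k : (k <= n)%N ->
  lip (fun x => @thread n x k) /\ mpres (fun x => @thread n x k).
Proof.
move=> kn; have [j E] : exists j, (k + j = n)%N by exists (n - k)%N; rewrite subnKC.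
elim: j k kn E => [|j IH] k kn E.
  move: E; rewrite addn0 => E; move: kn; rewrite {}E => _.
  have -> : (fun x => @thread n x n) = id by apply/funext => x; rewrite thread_top.
  by split => [x y|A mA]; first exact: lexx.
have kn' : (k < n)%N by rewrite -E addnS ltnS leq_addr.
have [l m] := IH k.+1 kn' (etrans (addSnnS _ _) E).
have -> : (fun x => @thread n x k) = @f k \o (fun x => @thread n x k.+1).
  by apply/funext => x /=; rewrite thread_step.
by split; [exact: lip_comp|exact: mpres_comp].
Qed.

Lemma thread_unique n (y y' : forall k, emm_T (X k)) : y n = y' n ->
  (forall k, (k < n)%N -> f (y k.+1) = y k) ->
  (forall k, (k < n)%N -> f (y' k.+1) = y' k) ->
  forall k, (k <= n)%N -> y k = y' k.
Proof.
move=> yn yP yP' k kn; have [j E] : exists j, (k + j = n)%N by exists (n - k)%N; rewrite subnKC.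
elim: j k kn E => [|j IH] k kn E; first by move: E; rewrite addn0 => ->.
have kn' : (k < n)%N by rewrite -E addnS ltnS leq_addr.
by rewrite -yP// -yP'// (IH k.+1 kn' (etrans (addSnnS _ _) E)).
Qed.

(** Each [g n] induces compatible maps to the levels [k <= n]. At every level the limit over [n] is
    taken along the same ultrafilter, so that compatibility survives. The ultrafilter contains all
    tails, so only [n >= k] matters. *)
Lemma compatible_limit W (g : forall n, emm_T W -> emm_T (X n)) :
  full_support W -> (forall n, lip (g n)) -> (forall n, mpres (g n)) ->
  exists h : forall k, emm_T W -> emm_T (X k),
    [/\ forall k, lip (h k), forall k, mpres (h k) &
        forall k w, f (h k.+1 w) = h k w].
Proof.
move=> Ws gl gm; have [U [UU Uoo]] := @ultraFilterLemma nat \oo _.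
have Uge k : U [set n | (k <= n)%N] by apply: Uoo; exact: nbhs_infty_ge.
pose G k n w := thread (g n w) k.
have UG k : U [set n | lip (G k n) /\ mpres (G k n)].
  apply: filterS (Uge k) => n /thread_lip_mpres[l m] /=.
  by split; [exact: (lip_comp l (gl n))|exact: (mpres_comp l m (gm n))].
pose h k := projT1 (cid (ultralimit_lip_mpres UU Ws (UG k))).
have hP k : [/\ lip (h k), mpres (h k) & forall w (e : RR), 0 < e ->
    U [set n | (emm_d (G k n w) (h k w) <= e%:E)%E]].
  by rewrite /h; case: cid.
exists h; split=> [k|k|k w]; [by have [] := hP k|by have [] := hP k|].
apply: emm_eq => e e0; have e20 : 0 < e / 2 by lra.
have [_ _ /(_ w _ e20) h0] := hP k; have [_ _ /(_ w _ e20) h1] := hP k.+1.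
have [n /= [[n0 n1] nk]] := ultra_meet UU (filterI h0 h1) (Uge k.+1).
have : (emm_d (G k n w) (f (h k.+1 w)) <= (e / 2)%:E)%E.
  by rewrite /G -thread_step//; exact: le_trans (fl _ _) n1.
move=> /emm_d_symle/emm_tri/(_ n0)/le_trans; apply; rewrite lee_fin; lra.
Qed.

End threads.

(** * Measures on the Cantor space *)

(** The latest bit is the head, so that reading one more bit is a [cons]. *)
Fixpoint pref (b : nat -> bool) n : seq bool :=
  if n is m.+1 then b m :: pref b m else [::].

Lemma eq_pref b b' n : (forall i, (i < n)%N -> b i = b' i) <-> pref b n = pref b' n.
Proof.
elim: n => // n [IH1 IH2]; split => [h|/= [bn /IH2 h] i].
  by rewrite /= h ?IH1// => i ilt; apply: h; exact: ltnW.
by rewrite ltnS leq_eqVlt => /orP[/eqP ->//|]; exact: h.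
Qed.

(** The sets that depend on the first [M] bits only. Over all [M] these are the clopen sets of the
    Cantor space. *)
Definition det M (C : set (nat -> bool)) :=
  forall b b', pref b M = pref b' M -> C b -> C b'.

Definition cantor_gen : set (set (nat -> bool)) := [set C | exists M, det M C].

Notation cantor := (g_sigma_algebraType cantor_gen).

Definition cyl (w : seq bool) : set (nat -> bool) := [set b | pref b (size w) = w].

Lemma det_le M N C : (M <= N)%N -> det M C -> det N C.
Proof.
move=> MN dC b b' /eq_pref h; apply: dC; apply/eq_pref => i iM.
by apply: h; exact: leq_trans MN.
Qed.

Lemma det_cyl w : det (size w) (cyl w).
Proof. by move=> b b' E; rewrite /cyl /= E. Qed.

Lemma det_measurable M C : det M C -> measurable (C : set cantor).
Proof. by move=> dC; apply: sub_sigma_algebra; exists M. Qed.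

Lemma cyl_split w : cyl w = cyl (false :: w) `|` cyl (true :: w).
Proof.
apply/seteqP; split => [b|b [|]] /=; rewrite /cyl /=; last 2 first.
- by case.
- by case.
by move=> E; rewrite E; case: (b _); [right|left].
Qed.

Lemma cyl_disj w : cyl (false :: w) `&` cyl (true :: w) = set0.
Proof. by rewrite -subset0 => b [[E _] [E' _]]; rewrite E in E'. Qed.

(** A set determined by [M] bits is a finite disjoint union of cylinders of length [M]. The
    induction is on the number [j] of bits that are still free. *)
Lemma det_ind M C (K : set (nat -> bool) -> Prop) : K set0 ->
  (forall A B, A `&` B = set0 -> K A -> K B -> K (A `|` B)) ->
  (forall w, size w = M -> K (cyl w)) -> det M C -> K C.
Proof.
move=> K0 KU Kc dC.
suff H j w : (size w + j = M)%N -> K (C `&` cyl w).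
  by rewrite -[C]setIT (_ : setT = cyl [::]); [exact: H|apply/seteqP; split].
elim: j w => [|j IH] w; rewrite ?addn0 ?addnS => sw.
  have [[b [Cb wb]]|/set0P/negP/negPn/eqP ->//] := pselect (C `&` cyl w !=set0).
  rewrite (_ : C `&` cyl w = cyl w); first exact: Kc.
  rewrite setIidr// => b' wb'; apply: dC Cb; rewrite -sw.
  by rewrite wb wb'.
rewrite cyl_split setIUr; apply: KU.
- by rewrite setIACA setIid cyl_disj setI0.
- by apply: IH; rewrite /= addSn.
- by apply: IH; rewrite /= addSn.
Qed.

Lemma det_measure_ext M C (m1 m2 : probability cantor RR) :
  (forall w, size w = M -> m1 (cyl w) = m2 (cyl w)) -> det M C -> m1 C = m2 C.
Proof.
move=> h dC.
suff : measurable (C : set cantor) /\ m1 C = m2 C by case.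
apply: (@det_ind M C (fun C => measurable (C : set cantor) /\ m1 C = m2 C)) => //.
- by rewrite !measure0.
- move=> A B AB [mA EA] [mB EB]; split; first exact: measurableU.
  have U (m : probability cantor RR) : m (A `|` B) = (m A + m B)%E by exact: measureU.
  by rewrite !U EA EB.
- by move=> w sw; split; [exact: det_measurable (@det_cyl w)|exact: h].
Qed.

Definition unit_measure : set (measurableTypeR RR) -> \bar RR :=
  mrestr (@lebesgue_measure RR) (measurable_itv `[0 : RR, 1[).

HB.instance Definition _ := Measure.on unit_measure.

Lemma unit_measure_setT : unit_measure setT = 1%E.
Proof.
by rewrite /unit_measure /mrestr setTI lebesgue_measure_itv /= lte_fin ltr01 -EFinB subr0.
Qed.

HB.instance Definition _ :=
  Measure_isProbability.Build _ _ _ unit_measure unit_measure_setT.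

(** * Kolmogorov extension for bits, by subdividing the unit interval *)

Section subdivision.
Variable p : seq bool -> RR.
Hypotheses (p_ge0 : forall w, 0 <= p w) (p_nil : p [::] = 1)
  (p_split : forall w, p w = p (false :: w) + p (true :: w)).

(* [lft w] is the left end of the subinterval of [0, 1[ of length [p w] attached
   to [w]; words are read backwards, the last bit coming first. *)
Fixpoint lft (w : seq bool) : RR :=
  if w is b :: w' then (if b then lft w' + p (false :: w') else lft w') else 0.

Fixpoint word (t : RR) n : seq bool :=
  if n is m.+1 then (lft (word t m) + p (false :: word t m) <= t) :: word t m
  else [::].

Definition code (t : RR) : nat -> bool :=
  fun n => lft (word t n) + p (false :: word t n) <= t.

Lemma pref_code t n : pref (code t) n = word t n.
Proof. by elim: n => //= n ->. Qed.

Lemma lft_bounds w : 0 <= lft w /\ lft w + p w <= 1.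
Proof.
elim: w => /= [|[] w [l0 l1]]; first by rewrite p_nil; lra.
  by have := p_split w; have := p_ge0 (false :: w); lra.
by have := p_split w; have := p_ge0 (true :: w); lra.
Qed.

(** The half-open intervals of the words of a given length tile [0, 1[, each splitting at
    [lft w + p (false :: w)]. A word with [p w = 0] receives an empty interval. *)
Lemma word_eq t w : 0 <= t < 1 ->
  word t (size w) = w <-> lft w <= t < lft w + p w.
Proof.
move=> t01; elim: w => [|b w IH] /=; first by rewrite p_nil add0r t01.
have := p_split w; have := p_ge0 (true :: w); have := p_ge0 (false :: w) => h1 h2 h3.
split=> [[E /IH]|].
  move: E; case: IH => _ IH E /[dup] /IH Ew; rewrite {}Ew in E; move: E.
  by case: b => /=; [|move/negbT; rewrite -ltNge] => ? /andP[? ?]; apply/andP; split; lra.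
move=> hb.
have /IH E : lft w <= t < lft w + p w.
  by case: b hb => /andP[? ?]; apply/andP; split; lra.
rewrite E; congr cons; case: b hb => /andP[? ?]; first by lra.
by apply/negbTE; rewrite -ltNge; lra.
Qed.

Lemma measurable_code : measurable_fun setT (code : measurableTypeR RR -> cantor).
Proof.
apply: (@measurability _ _ _ cantor _ _ cantor_gen erefl) => _ [C [M dC] <-]; rewrite setTI.
pose K (C : set (nat -> bool)) := measurable (code @^-1` C : set (measurableTypeR RR)).
apply: (@det_ind M C K) => //.
- by rewrite /K preimage_set0; exact: measurable0.
- by move=> A B _ mA mB; rewrite /K preimage_setU; exact: measurableU.
- move=> w _; rewrite /K (_ : _ @^-1` _ = [set t | word t (size w) = w]); last first.
    by apply/seteqP; split => t; rewrite /= /cyl /= pref_code.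
  elim: w => [|b w IH] /=.
    rewrite (_ : [set _ | _] = setT); first exact: (@measurableT _ (measurableTypeR RR)).
    by apply/seteqP; split.
  rewrite (_ : [set _ | _] = [set t | word t (size w) = w] `&`
      (if b then `[lft w + p (false :: w), +oo[%classic
       else `]-oo, lft w + p (false :: w)[%classic)); last first.
    apply/seteqP; split => t /=.
      move=> [E /[dup] Ew ->]; split => //; rewrite Ew in E.
      case: b E => E /=; rewrite in_itv /= ?andbT//.
      by rewrite ltNge E.
    move=> [-> h]; congr cons; case: b h => /=; rewrite in_itv /= ?andbT//.
    by move=> h; apply/negbTE; rewrite -ltNge.
  by apply: measurableI => //; case: b; exact: measurable_itv.
Qed.

(** [Q] is the law of [code] under Lebesgue measure: a cylinder pulls back to an interval of the
    prescribed length. *)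
Lemma cantor_measure : exists Q : probability cantor RR,
  forall w, Q (cyl w) = (p w)%:E.
Proof.
have [Q QE] := law_exists unit_measure measurable_code.
exists Q => w; rewrite QE /= /unit_measure /mrestr.
have [l0 l1] := lft_bounds w.
rewrite (_ : _ `&` _ = `[lft w, lft w + p w[%classic); last first.
  apply/seteqP; split => t /=; rewrite /cyl /= pref_code !in_itv /=.
    by move=> [/word_eq h] /h.
  move=> h; have t01 : 0 <= t < 1 by move/andP: h => [? ?]; apply/andP; split; lra.
  by split => //; apply/word_eq.
rewrite lebesgue_measure_itv /= lte_fin; case: ifPn => [_|].
  by rewrite -EFinB; congr EFin; lra.
by rewrite -leNgt => h; congr EFin; have := p_ge0 w; lra.
Qed.

End subdivision.

(** Each cylinder has a mass that is eventually constant in [n]. These constants are additive, and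
    so define a measure. *)
Lemma cantor_limit (m : nat -> probability cantor RR) :
  (forall M, exists N, forall n C, (N <= n)%N -> det M C -> m n C = m N C) ->
  exists Q : probability cantor RR, forall M, exists N, forall n C, (N <= n)%N ->
    det M C -> Q C = m n C.
Proof.
move=> /choice[N NP].
pose p w := fine (m (N (size w)) (cyl w)).
have pE w : (p w)%:E = m (N (size w)) (cyl w).
  by rewrite fineK// fin_num_measure//; exact: det_measurable (@det_cyl w).
have [w||w|Q QE] := @cantor_measure p.
- by rewrite -lee_fin pE measure_ge0.
- have -> : p [::] = fine 1%E; last by [].
  rewrite /p (_ : cyl [::] = setT) ?probability_setT//.
  by apply/seteqP; split.
- apply: EFin_inj; rewrite EFinD !pE /=.
  (* Past both thresholds the three masses are values of the same measure [m n], whose additivity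
     applies. *)
  set n := maxn (N (size w)) (N (size w).+1).
  have <- := NP _ n _ (leq_maxl _ _) (@det_cyl w).
  have <- := NP _ n _ (leq_maxr _ _) (@det_cyl (false :: w)).
  have <- := NP _ n _ (leq_maxr _ _) (@det_cyl (true :: w)).
  rewrite cyl_split; apply: measureU.
  - exact: det_measurable (@det_cyl (false :: w)).
  - exact: det_measurable (@det_cyl (true :: w)).
  - exact: cyl_disj.
exists Q => M; exists (N M) => n C Nn; apply: det_measure_ext => w sw.
rewrite QE pE sw; apply/esym; apply: NP => //; rewrite -sw; exact: det_cyl.
Qed.

(** * Realisation of an inverse system on the Cantor space *)

Section measurable_sets.
Context d (T : measurableType d).
Implicit Types A B : T -> Prop.

Lemma measurable_forall (A : nat -> T -> Prop) :
  (forall n, measurable [set t | A n t]) -> measurable [set t | forall n, A n t].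
Proof.
move=> mA; rewrite (_ : [set _ | _] = \bigcap_n [set t | A n t]).
  exact: bigcapT_measurable.
by apply/seteqP; split => [t h n _|t h n]; exact: h.
Qed.

Lemma measurable_exists (A : nat -> T -> Prop) :
  (forall n, measurable [set t | A n t]) -> measurable [set t | exists n, A n t].
Proof.
move=> mA; rewrite (_ : [set _ | _] = \bigcup_n [set t | A n t]).
  by apply: bigcup_measurable => n _.
by apply/seteqP; split => t [n]; exists n.
Qed.

Lemma measurable_const (p : Prop) : measurable [set t : T | p].
Proof.
have [h|h] := pselect p.
  by rewrite (_ : [set _ | _] = setT); [exact: measurableT|apply/seteqP; split].
by rewrite (_ : [set _ | _] = set0); [exact: measurable0|apply/seteqP; split].
Qed.

Lemma measurable_impl A B : measurable [set t | A t] -> measurable [set t | B t] ->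
  measurable [set t | A t -> B t].
Proof.
move=> mA mB; rewrite (_ : [set _ | _] = ~` [set t | A t] `|` [set t | B t]).
  by apply: measurableU => //; exact: measurableC.
apply/seteqP; split => t /= => [h|[|h _]//].
by have [At|nAt] := pselect (A t); [right; exact: h|left].
Qed.

Lemma measurable_and A B : measurable [set t | A t] -> measurable [set t | B t] ->
  measurable [set t | A t /\ B t].
Proof. exact: measurableI. Qed.

Lemma measurable_not A : measurable [set t | A t] -> measurable [set t | ~ A t].
Proof. exact: measurableC. Qed.

Lemma probability_eq_on (R : realType) (P : probability T R) (A B G : set T) :
  measurable A -> measurable B -> measurable G -> P G = 1%E ->
  (forall t, G t -> (A t <-> B t)) -> P A = P B.
Proof.
move=> mA mB mG PG h; have PG' : ((1 - 0)%:E <= P G)%E by rewrite PG subr0.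
apply/eqP; rewrite eq_le; apply/andP; split.
  have := measure_le_off mA mB mG PG'; rewrite adde0; apply.
  by move=> t [At /h]; case => + _; exact.
have := measure_le_off mB mA mG PG'; rewrite adde0; apply.
by move=> t [Bt /h]; case => _; exact.
Qed.

Lemma probability_bigcap1 (R : realType) (P : probability T R) (E : nat -> set T) :
  (forall k, measurable (E k)) -> (forall k, P (E k) = 1%E) ->
  P (\bigcap_k E k) = 1%E.
Proof.
move=> mE PE; have mI := bigcapT_measurable mE.
have mIn n : measurable (\big[setI/setT]_(i < n) E i) by apply: bigsetI_measurable.
have PIn n : P (\big[setI/setT]_(i < n) E i) = 1%E.
  elim: n => [|n IH]; first by rewrite big_ord0 probability_setT.
  rewrite big_ord_recr /= -IH.
  apply: (probability_eq_on (measurableI _ _ (mIn n) (mE n)) (mIn n) (mE n) (PE n)).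
  by move=> t Et; split => [[]|].
apply/eqP; rewrite eq_le probability_le1//=.
have -> : \bigcap_k E k = \bigcap_n \big[setI/setT]_(i < n) E i.
  apply/seteqP; split => t h n _.
    by elim/big_rec: _ => // i A _ At; split => //; exact: h.
  have := h n.+1 I; rewrite big_ord_recr => -[_]; exact.
apply: measure_bigcap_ge => // [n m nm|n]; last by rewrite PIn.
by rewrite -(subnKC nm) big_split_ord /= => t [].
Qed.

End measurable_sets.

Lemma measurable_emm_eq d (T : measurableType d) X (u v : T -> emm_T X) :
  measurable_fun setT u -> measurable_fun setT v -> measurable [set t | u t = v t].
Proof.
move=> mu mv; have [s sP] := emm_separableP X.
have pos (j : nat) : 0 < j.+1%:R^-1 :> RR by rewrite invr_gt0.
rewrite (_ : [set _ | _] = [set t | forall j, exists i,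
   cball (s i) (j.+1%:R^-1) (u t) /\ cball (s i) (j.+1%:R^-1) (v t)]); last first.
  apply/seteqP; split => t /=.
    move=> <- j; have [i /ltW/emm_d_symle h] := sP (u t) _ (pos j); by exists i.
  move=> h; apply: emm_eq => e e0; have [|j je] := @invS_lt (e / 2); first by lra.
  have [i [/emm_d_symle iu iv]] := h j; apply: (le_trans (emm_tri iu iv)).
  by rewrite lee_fin; move: je; set a := _^-1; lra.
apply: measurable_forall => j; apply: measurable_exists => i.
by apply: measurable_and; rewrite -[X in measurable X]setTI;
  [apply: mu|apply: mv] => //; exact: measurable_cball.
Qed.

Section realization.
Variables (X : nat -> emmspace) (f : forall k, emm_T (X k.+1) -> emm_T (X k)).
Hypotheses (fl : forall k, lip (@f k)) (fm : forall k, mpres (@f k)).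

Local Notation thread := (thread f).

Definition dense_seq k : nat -> emm_T (X k) := projT1 (cid (emm_separableP (X k))).

Lemma dense_seqP k x (e : RR) : 0 < e -> exists i, (emm_d x (dense_seq k i) < e%:E)%E.
Proof. by rewrite /dense_seq; case: cid => s /= sP; exact: sP. Qed.

Definition rad (j : nat) : RR := j.+1%:R^-1.

Lemma rad_gt0 j : 0 < rad j. Proof. by rewrite invr_gt0. Qed.

Definition bidx (k j i : nat) : nat := pickle (k, j, i).

Definition bdec (m : nat) : nat * nat * nat := odflt (0, 0, 0)%N (unpickle m).

Definition level m := (bdec m).1.1.

Lemma bdecK k j i : bdec (bidx k j i) = (k, j, i).
Proof. by rewrite /bdec /bidx pickleK. Qed.

Lemma level_bidx k j i : level (bidx k j i) = k.
Proof. by rewrite /level bdecK. Qed.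

(** For [m] coding the triple [(k, j, i)], this compares [y k] with the [i]-th dense point at scale
    $1/(j+1)$. For each [k] and [j] some [i] answers yes, so the bits determine [y]. *)
Definition bit (y : forall k, emm_T (X k)) m : bool :=
  (emm_d (y (bdec m).1.1) (dense_seq _ (bdec m).2) < (rad (bdec m).1.2)%:E)%E.

(* Bits of level above [n] are switched off, since [thread x] is junk there. *)
Definition bits n (x : emm_T (X n)) : cantor := fun m => (level m <= n)%N && bit (thread x) m.

(** Truncation is the trace on codes of the projection to level [n]; it makes the laws at different
    levels comparable. *)
Definition trunc n (b : cantor) : cantor := fun m => (level m <= n)%N && b m.

Lemma bits_thread n N x m : (N <= n)%N -> (level m <= N)%N ->
  @bits n x m = bits (thread x N) m.
Proof.
move=> Nn mN; rewrite /bits mN (leq_trans mN Nn) /bit /=.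
congr (emm_d _ _ < _)%E; apply: (@thread_unique _ f N) => //.
- by rewrite thread_top.
- by move=> k kN; rewrite thread_step// (leq_trans kN).
- by move=> k kN; rewrite thread_step.
Qed.

Lemma trunc_bits n n' x : (n <= n')%N -> trunc n (@bits n' x) = bits (thread x n).
Proof.
move=> nn'; apply/funext => m; rewrite /trunc.
have [mn|mn] := leqP (level m) n; first by rewrite (@bits_thread _ n).
by rewrite /bits (leqNgt _ n) mn.
Qed.

Lemma measurable_to_cantor d (T : measurableType d) (q : T -> cantor) :
  (forall m, measurable [set t | q t m]) -> measurable_fun setT q.
Proof.
move=> mq; apply: (@measurability _ _ _ cantor _ _ cantor_gen erefl) => _ [C [M dC] <-].
rewrite setTI; pose K (C : set (nat -> bool)) := measurable (q @^-1` C).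
apply: (@det_ind M C K) => //.
- by rewrite /K preimage_set0; exact: measurable0.
- by move=> A B _ mA mB; rewrite /K preimage_setU; exact: measurableU.
- move=> w _; rewrite /K; elim: w => [|b w IH].
    by rewrite (_ : _ @^-1` _ = setT); [exact: measurableT|apply/seteqP; split].
  rewrite (_ : _ @^-1` _ = q @^-1` cyl w `&` [set t | q t (size w) = b]).
    apply: measurableI => //; case: b; first exact: mq.
    rewrite (_ : [set _ | _] = ~` [set t | q t (size w)]); first exact: measurableC.
    by apply/seteqP; split => t /=; [move=> -> |move/negP/negbTE].
  apply/seteqP; split => t; rewrite /preimage /cyl /=; first by move=> [-> ->].
  by move=> [-> ->].
Qed.

Lemma measurable_bit m : measurable [set b : cantor | b m].
Proof.
by apply: (@det_measurable m.+1) => b b' /= [-> _].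
Qed.

Lemma measurable_bits n : measurable_fun setT (@bits n).
Proof.
apply: measurable_to_cantor => m; rewrite /bits.
have [mn|_] := leqP (level m) n; last exact: (measurable_const _ false).
have [l _] := thread_lip_mpres fl fm mn.
rewrite (_ : [set _ | _] = (fun x => thread x (level m)) @^-1`
  [set y | (emm_d (dense_seq _ (bdec m).2) y < (rad (bdec m).1.2)%:E)%E]); last first.
  by apply/seteqP; split => x; rewrite /preimage /bit /= emm_d_sym.
rewrite -[X in measurable X]setTI; apply: lip_measurable => //.
exact: measurable_ball.
Qed.

Lemma measurable_trunc n : measurable_fun setT (trunc n).
Proof.
apply: measurable_to_cantor => m; rewrite /trunc.
by case: leqP => _; [exact: measurable_bit|exact: (measurable_const _ false)].
Qed.

Lemma measurable_preimage d d' (T : measurableType d) (T' : measurableType d')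
    (q : T -> T') A : measurable_fun setT q -> measurable A -> measurable (q @^-1` A).
Proof. by move=> mq mA; rewrite -[X in measurable X]setTI; exact: mq. Qed.

Lemma bits_law_exists : exists Q : probability cantor RR, forall n C,
  measurable C -> Q (trunc n @^-1` C) = emm_mu (@bits n @^-1` C).
Proof.
have mE : forall n, exists m : probability cantor RR, forall C, m C = emm_mu (@bits n @^-1` C).
  by move=> n; exact: law_exists (@measurable_bits n).
have [m mP] := choice mE.
have [M|Q QP] := @cantor_limit m.
  (* The first [M] bits involve finitely many levels. Beyond the largest one their law no longer
     changes, since the projections preserve the measures. *)
  exists (\max_(i < M) level i)%N => n C; set N := (\max_(i < M) _)%N => Nn dC.
  have [l mp] := thread_lip_mpres fl fm Nn.
  rewrite !mP mp; last exact: (measurable_preimage (@measurable_bits N) (det_measurable dC)).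
  congr (_ _); apply/seteqP; split => x; apply: dC; apply/eq_pref => i iM.
    by apply: bits_thread => //; exact: (leq_bigmax (Ordinal iM)).
  by apply/esym; apply: bits_thread => //; exact: (leq_bigmax (Ordinal iM)).
exists Q => n.
have [Q1 Q1E] := law_exists Q (@measurable_trunc n).
have [Q2 Q2E] := law_exists (@emm_mu (X n)) (@measurable_bits n).
suff H : forall C, measurable C -> Q1 C = Q2 C by move=> C mC; rewrite -Q1E -Q2E H.
apply: (@probability_unique _ cantor _ cantor_gen) => //.
  move=> A B [M dA] [M' dB]; exists (maxn M M') => b b' E [Ab Bb]; split.
    exact: (det_le (leq_maxl _ _) dA E Ab).
  exact: (det_le (leq_maxr _ _) dB E Bb).
move=> A [M dA]; rewrite Q1E Q2E.
have dA' : det M (trunc n @^-1` A).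
  move=> b b' /eq_pref E; apply: dA; apply/eq_pref => i iM.
  by rewrite /trunc E.
(* At an index above [N] the law [Q] can be read off, and above [n] the truncated bits are those of
   the projection to [X n]. *)
have [N NP] := QP M; rewrite (NP (maxn N n) _ (leq_maxl _ _) dA') mP.
have [l mp] := thread_lip_mpres fl fm (leq_maxr N n).
rewrite mp; last exact: (measurable_preimage (@measurable_bits n) (det_measurable dA)).
congr (_ _); apply/seteqP; split => x; rewrite /preimage /= trunc_bits//;
  exact: leq_maxr.
Qed.

(* The bits of level [k] of [b] prescribe a Cauchy family of dense points. *)
Definition good k (b : cantor) : Prop :=
  (forall j, exists i, b (bidx k j i)) /\
  (forall j i j' i', b (bidx k j i) -> b (bidx k j' i') ->
     (emm_d (dense_seq k i) (dense_seq k i') <= (rad j + rad j')%:E)%E).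

Definition decodes k (b : cantor) x := forall j i, b (bidx k j i) ->
  (emm_d x (dense_seq k i) <= (rad j)%:E)%E.

Lemma rad_le j j' : (j <= j')%N -> rad j' <= rad j.
Proof. by move=> jj; rewrite lef_pV2 ?posrE// ler_nat. Qed.

Lemma decodes_exists k b : good k b -> exists x, @decodes k b x.
Proof.
move=> [/choice[i iP] h].
have [e e0|x xP] := @emm_completeP (X k) (fun j => dense_seq k (i j)).
  have [|j je] := @invS_lt (e / 2); first by lra.
  exists j => m n jm jn; apply: (le_trans (h _ _ _ _ (iP m) (iP n))); rewrite lee_fin.
  by have := rad_le jm; have := rad_le jn; move: je; rewrite -/(rad j); lra.
exists x => j l bl; apply/lee_addgt0Pr => e e0.
have [|N NP] := xP (e / 2); first by lra.
have [|n ne] := @invS_lt (e / 2); first by lra.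
have h1 := NP (maxn N n) (leq_maxl _ _).
have h2 := h _ _ _ _ (iP (maxn N n)) bl.
apply: (le_trans (emm_tri (emm_d_symle h1) h2)); rewrite -EFinD lee_fin.
by have := rad_le (leq_maxr N n); move: ne; rewrite -/(rad n); lra.
Qed.

Lemma decodes_unique k b x y : good k b -> @decodes k b x -> @decodes k b y -> x = y.
Proof.
move=> [h _] bx by_; apply: emm_eq => e e0; have [|j je] := @invS_lt (e / 2); first by lra.
have [i bi] := h j; apply: (le_trans (emm_tri (bx _ _ bi) (emm_d_symle (by_ _ _ bi)))).
by move: je; rewrite -/(rad j) lee_fin; lra.
Qed.

Definition decode k (b : cantor) : emm_T (X k) :=
  if pselect (good k b) is left h then projT1 (cid (decodes_exists h)) else point.

Lemma decode_good k b : good k b -> decodes b (decode k b).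
Proof. by rewrite /decode; case: pselect => // h _; case: cid. Qed.

Lemma decode_bad k b : ~ good k b -> decode k b = point.
Proof. by rewrite /decode; case: pselect. Qed.

Lemma decode_eq k b b' : (forall j i, b (bidx k j i) = b' (bidx k j i)) ->
  decode k b = decode k b'.
Proof.
move=> E; have gE : good k b <-> good k b'.
  split => -[h1 h2]; split.
  - by move=> j; have [i] := h1 j; exists i; rewrite -E.
  - by move=> j i j' i'; rewrite -!E; exact: h2.
  - by move=> j; have [i] := h1 j; exists i; rewrite E.
  - by move=> j i j' i'; rewrite !E; exact: h2.
have [g|ng] := pselect (good k b); last first.
  by rewrite !decode_bad// -gE.
have g' := iffLR gE g; apply: (decodes_unique g); first exact: decode_good.
by move=> j i; rewrite E; exact: decode_good.
Qed.

Lemma decode_trunc n k b : (k <= n)%N -> decode k (trunc n b) = decode k b.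
Proof. by move=> kn; apply: decode_eq => j i; rewrite /trunc level_bidx kn. Qed.

Lemma decode_bits n x k : (k <= n)%N -> decode k (@bits n x) = thread x k.
Proof.
move=> kn; have bE j i : bits x (bidx k j i) =
    (emm_d (thread x k) (dense_seq k i) < (rad j)%:E)%E.
  by rewrite /bits level_bidx kn /bit bdecK.
have g : good k (bits x).
  split=> [j|j i j' i'].
    by have [i xi] := dense_seqP (thread x k) (rad_gt0 j); exists i; rewrite bE.
  rewrite !bE => /ltW/emm_d_symle h1 /ltW h2; exact: emm_tri h1 h2.
apply: (decodes_unique g); first exact: decode_good.
by move=> j i; rewrite bE; exact: ltW.
Qed.

Lemma measurable_good k : measurable [set b | good k b].
Proof.
apply: measurable_and.
  by apply: measurable_forall => j; apply: measurable_exists => i; exact: measurable_bit.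
do 4![apply: measurable_forall => ?].
do 2![apply: measurable_impl; first exact: measurable_bit].
exact: measurable_const.
Qed.

(** For a good code, lying in a closed ball is a countable condition on bits: every dense point
    named by a bit of precision [rad j] lies within [r + rad j] of the centre. On bad codes [decode]
    is constant. *)
Lemma measurable_decode k : measurable_fun setT (decode k).
Proof.
apply: cball_measurable_fun => x r.
rewrite (_ : _ @^-1` _ = [set b | (good k b -> forall j i, b (bidx k j i) ->
    (emm_d x (dense_seq k i) <= (r + rad j)%:E)%E) /\
    (~ good k b -> (emm_d x point <= r%:E)%E)]); last first.
  apply/seteqP; split => b; rewrite /preimage /cball /=.
    move=> h; split => [/decode_good g j i /g h'|/decode_bad <-//].
    exact: emm_tri h h'.
  move=> [h1 h2]; have [g|ng] := pselect (good k b); last first.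
    by rewrite decode_bad//; exact: h2.
  apply/lee_addgt0Pr => e e0; have [|j je] := @invS_lt (e / 2); first by lra.
  have [i bi] := g.1 j.
  apply: (le_trans (emm_tri (h1 g _ _ bi) (emm_d_symle (decode_good g bi)))).
  by move: je; rewrite -/(rad j) -EFinD lee_fin; lra.
have mg := measurable_good k.
apply: measurable_and; apply: measurable_impl => //.
- do 2![apply: measurable_forall => ?]; apply: measurable_impl; first exact: measurable_bit.
  exact: measurable_const.
- exact: measurable_not.
- exact: measurable_const.
Qed.

Lemma realization_exists : exists (Q : probability cantor RR)
    (Z : forall k, cantor -> emm_T (X k)),
  [/\ forall k, measurable_fun setT (Z k),
      forall k A, measurable A -> Q (Z k @^-1` A) = emm_mu A &
      forall k t, f (Z k.+1 t) = Z k t].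
Proof.
have [Q QP] := bits_law_exists.
(* Events that involve only levels up to [n] have their probability computed in [X n]. *)
have trE n (C : set cantor) : measurable C -> (forall b, C (trunc n b) <-> C b) ->
    Q C = emm_mu (@bits n @^-1` C).
  move=> mC h; rewrite -QP//; congr (Q _); apply/seteqP; split => b /h //.
have law k A : measurable A -> Q (decode k @^-1` A) = emm_mu A.
  move=> mA; rewrite (trE k); first last.
  - by move=> b; rewrite /preimage /= decode_trunc.
  - exact: (measurable_preimage (@measurable_decode k) mA).
  by congr (_ _); apply/seteqP; split => x; rewrite /preimage /= decode_bits// thread_top.
pose E k := [set b | f (decode k.+1 b) = decode k b].
have mE k : measurable (E k).
  apply: measurable_emm_eq; last exact: measurable_decode.
  apply: (measurableT_comp (lip_measurable (@fl k))); exact: measurable_decode.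
have QE k : Q (E k) = 1%E.
  rewrite (trE k.+1)//; last by move=> b; rewrite /E /= !decode_trunc.
  rewrite (_ : _ @^-1` _ = setT) ?probability_setT//.
  by apply/seteqP; split => // x _; rewrite /preimage /E /= !decode_bits// thread_step.
pose G := \bigcap_k E k.
have mG : measurable G by exact: bigcapT_measurable.
have QG : Q G = 1%E by exact: probability_bigcap1.
have [t0 Gt0] : G !=set0.
  apply/set0P/negP => /eqP G0; move: QG; rewrite G0 measure0 => /esym/eqP.
  by rewrite onee_eq0.
(* Codes in the null set where compatibility fails are replaced by one fixed good code, so that
   [f (Z k.+1 t) = Z k t] holds for every [t]. *)
pose sel t := if pselect (G t) then t else t0.
have Gsel t : G (sel t) by rewrite /sel; case: pselect.
exists Q, (fun k t => decode k (sel t)).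
have mZ k A : measurable A ->
    measurable ((fun t => decode k (sel t)) @^-1` A).
  move=> mA; rewrite (_ : _ @^-1` _ = [set t | (G t -> A (decode k t)) /\
      (~ G t -> A (decode k t0))]); last first.
    apply/seteqP; split => t; rewrite /preimage /sel /=; case: pselect => g.
    - by split.
    - by split.
    - by move=> [h _]; exact: h.
    - by move=> [_ h]; exact: h.
  apply: measurable_and; apply: measurable_impl => //.
  - exact: (measurable_preimage (@measurable_decode k) mA).
  - exact: measurable_not.
  - exact: measurable_const.
split=> [k|k A mA|k t].
- by move=> _ A mA; rewrite setTI; exact: mZ.
- rewrite -law//; apply: (probability_eq_on _ _ mG QG); first exact: mZ.
    exact: (measurable_preimage (@measurable_decode k) mA).
  by move=> t Gt; rewrite /preimage /sel /=; case: pselect.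
- exact: Gsel.
Qed.

End realization.

(** * Inverse limits *)

(** An alias that records the default point [t0], since measurable types are pointed and a bare type
    is not. *)
Definition pointed_at (T : Type) (t0 : T) : Type := T.
HB.instance Definition _ T (t0 : T) := gen_eqMixin (pointed_at t0).
HB.instance Definition _ T (t0 : T) := gen_choiceMixin (pointed_at t0).
HB.instance Definition _ T (t0 : T) := isPointed.Build (pointed_at t0) t0.

(** * An extended mm-space from a distance and a random point *)

Section build.
Variables (T : Type) (t0 : T) (dd : T -> T -> \bar RR).
Hypotheses (dd_ge0 : forall x y, (0 <= dd x y)%E)
  (dd_eq0 : forall x y, dd x y = 0%E <-> x = y)
  (dd_sym : forall x y, dd x y = dd y x)
  (dd_tri : forall x y z, (dd x z <= dd x y + dd y z)%E)
  (dd_complete : forall u : nat -> T,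
    (forall e : RR, 0 < e -> exists N : nat, forall m n : nat,
       (N <= m)%N -> (N <= n)%N -> (dd (u m) (u n) <= e%:E)%E) ->
    exists l, forall e : RR, 0 < e ->
      exists N : nat, forall n : nat, (N <= n)%N -> (dd (u n) l <= e%:E)%E)
  (dd_separable : exists s : nat -> T, forall x (e : RR), 0 < e ->
     exists n, (dd x (s n) <= e%:E)%E).
Context d (O : measurableType d) (Q : probability O RR) (q : O -> T).
Hypothesis mq : forall x (r : RR), measurable (q @^-1` [set y | (dd x y <= r%:E)%E]).

Let G : set (set (pointed_at t0)) := [set U | forall x, U x -> exists e : RR,
  Rdefinitions.Rlt (Rdefinitions.IZR BinNums.Z0) e /\ [set y | (dd x y < e%:E)%E] `<=` U].

Let B : measurableType _ := g_sigma_algebraType G.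

Let complete (u : nat -> B) :
  (forall e : RR, Rdefinitions.Rlt (Rdefinitions.IZR BinNums.Z0) e ->
     exists N : nat, forall m n : nat,
       leq N m -> leq N n -> (dd (u m) (u n) < e%:E)%E) ->
  exists l : B, forall e : RR, Rdefinitions.Rlt (Rdefinitions.IZR BinNums.Z0) e ->
    exists N : nat, forall n : nat, leq N n -> (dd (u n) l < e%:E)%E.
Proof.
move=> cu; have [e /R0ltE/cu[N NP]|l lP] := @dd_complete u.
  by exists N => m n /NP h /h /ltW.
exists l => e /R0ltE e0; have [|N NP] := lP (e / 2); first by lra.
by exists N => n /NP /le_lt_trans; apply; rewrite lte_fin; lra.
Qed.

Let separable : exists s : nat -> B, forall (x : B) (e : RR),
  Rdefinitions.Rlt (Rdefinitions.IZR BinNums.Z0) e -> exists n, (dd x (s n) < e%:E)%E.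
Proof.
have [s sP] := dd_separable; exists s => x e /R0ltE e0.
have [|n xn] := sP x (e / 2); first by lra.
by exists n; apply: (le_lt_trans xn); rewrite lte_fin; lra.
Qed.

Lemma emm_build : exists (Y : emmspace) (i : T -> emm_T Y) (j : emm_T Y -> T),
  [/\ cancel i j, cancel j i, forall x y, emm_d (i x) (i y) = dd x y,
      measurable_fun setT (i \o q) &
      forall A, emm_mu A = Q ((i \o q) @^-1` A)].
Proof.
pose mk := @EMMSpace _ B dd dd_ge0 dd_eq0 dd_sym dd_tri complete separable erefl.
pose P0 : probability B RR := @dirac _ B t0 RR.
have mq' : measurable_fun setT (q : O -> emm_T (mk P0)).
  by apply: cball_measurable_fun => x r; exact: mq.
have [Q' Q'E] := law_exists Q mq'.
by exists (mk Q'), id, id; split.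
Qed.

End build.

(** * Inverse limits and the mass of their balls *)

Section inverse_limit.
Variables (X : nat -> emmspace) (f : forall k, emm_T (X k.+1) -> emm_T (X k)).
Hypotheses (fl : forall k, lip (@f k)) (fm : forall k, mpres (@f k)).

Definition compatible (x : forall k, emm_T (X k)) := forall k, f (x k.+1) = x k.

Definition is_limit (Y : emmspace) (pr : forall k, emm_T Y -> emm_T (X k)) :=
  [/\ full_support Y,
      forall k, mpres (pr k),
      forall y, compatible (pr^~ y),
      forall y y' a, (emm_d y y' <= a)%E <->
        forall k, (emm_d (pr k y) (pr k y') <= a)%E &
      forall x, compatible x ->
        (forall r : RR, 0 < r -> exists2 c : \bar RR, (0 < c)%E &
          forall k, (c <= emm_mu (cball (x k) r))%E) ->
        exists y, forall k, pr k y = x k].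

Lemma compatible_cball x (r : RR) k k' : compatible x -> (k <= k')%N ->
  (emm_mu (cball (x k') r) <= emm_mu (cball (x k) r))%E.
Proof.
move=> cx; elim: k' => [|k' IH]; first by rewrite leqn0 => /eqP ->.
rewrite leq_eqVlt => /orP[/eqP ->//|/IH h]; apply: le_trans h.
rewrite [leRHS]fm; last exact: measurable_cball.
apply: le_measure; rewrite ?inE; first exact: measurable_cball.
  exact/(measurable_preimage (lip_measurable (@fl _)))/measurable_cball.
by move=> y xy; rewrite /preimage /cball /= -cx; exact: le_trans (fl _ _) xy.
Qed.

Lemma Bnbhd_measure_le (Y : emmspace) (r dl : RR) (N : seq (emm_T Y)) :
  (forall y, List.In y N -> (emm_mu (cball y r) <= dl%:E)%E) ->
  (emm_mu (Bnbhd r N) <= ((size N)%:R * dl)%:E)%E.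
Proof.
elim: N => [|y N IH] h.
  rewrite (_ : Bnbhd _ _ = set0) ?measure0 ?mul0r//.
  by rewrite -subset0 => x [y []].
rewrite Bnbhd_cons /= -add1n natrD mulrDl mul1r EFinD.
apply: (le_trans (measureU2 _ (measurable_cball _ _) (measurable_Bnbhd _ _))).
apply: leeD; first by apply: h; left.
by apply: IH => z zN; apply: h; right.
Qed.

(** Each discarded centre has a ball of mass below [dl], and there are at most [size N] of them. *)
Lemma Bnbhd_filter_measure (Y : emmspace) (r dl : RR) (N : seq (emm_T Y)) : 0 <= dl ->
  (emm_mu (Bnbhd r N) <= emm_mu (Bnbhd r [seq y <- N | dl%:E <= emm_mu (cball y r)]%E)
    + ((size N)%:R * dl)%:E)%E.
Proof.
move=> dl0; pose p (y : emm_T Y) := (dl%:E <= emm_mu (cball y r))%E.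
pose N' := [seq y <- N | ~~ p y].
apply: (@le_trans _ _ (emm_mu (Bnbhd r [seq y <- N | p y] `|` Bnbhd r N'))).
  apply: le_measure; rewrite ?inE; first exact: measurable_Bnbhd.
    by apply: measurableU; exact: measurable_Bnbhd.
  move=> x [y [yN xy]]; case: (boolP (p y)) => py; [left|right]; exists y; split => //;
    by apply/List.filter_In.
have mB' N0 : measurable (Bnbhd r N0 : set (emm_T Y)) by exact: measurable_Bnbhd.
apply: (le_trans (measureU2 (@emm_mu Y) (mB' _) (mB' _))); apply: leeD => //.
apply: (@le_trans _ _ ((size N')%:R * dl)%:E); last first.
  by rewrite lee_fin ler_wpM2r// ler_nat size_filter count_size.
apply: Bnbhd_measure_le => y /List.filter_In[_]; rewrite -ltNge; exact: ltW.
Qed.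

Hypothesis cov : forall r k : RR, 0 < r -> 0 < k -> k < 1 ->
  exists K : nat, forall n, exists N : seq (emm_T (X n)),
    (size N <= K)%N /\ ((1 - k)%:E <= emm_mu (Bnbhd r N))%E.

Variables (Q : probability cantor RR) (Z : forall k, cantor -> emm_T (X k)).
Hypotheses (mZ : forall k, measurable_fun setT (Z k))
  (lZ : forall k A, measurable A -> Q (Z k @^-1` A) = emm_mu A)
  (cZ : forall t, compatible (Z^~ t)).

Definition Ball (x : forall k, emm_T (X k)) (r : RR) : set cantor :=
  [set t | forall k, (emm_d (x k) (Z k t) <= r%:E)%E].

Lemma measurable_Ball x r : measurable (Ball x r).
Proof.
apply: measurable_forall => k.
by have := measurable_preimage (@mZ k) (measurable_cball (x k) r).
Qed.

(** A ball for $\sup_k d_k$ is the decreasing intersection of the balls at the levels [k], because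
    the maps [f] are 1-Lipschitz. *)
Lemma Ball_ge x (r : RR) (c : \bar RR) : compatible x ->
  (forall k, (c <= emm_mu (cball (x k) r))%E) -> (c <= Q (Ball x r))%E.
Proof.
move=> cx h; rewrite (_ : Ball x r = \bigcap_k (Z k @^-1` cball (x k) r)); last first.
  by apply/seteqP; split => [t h' k _|t h' k]; exact: h'.
apply: measure_bigcap_ge => [k|n m nm|k]; last by rewrite lZ//; exact: measurable_cball.
  exact: (measurable_preimage (@mZ k) (measurable_cball (x k) r)).
elim: m nm => [|m IH]; first by rewrite leqn0 => /eqP ->.
rewrite leq_eqVlt => /orP[/eqP ->//|/IH h']; apply: subset_trans h' => t.
by move=> h1; rewrite /preimage /cball /= -cx -(@cZ t m); exact: le_trans (fl _ _) h1.
Qed.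

Lemma Ball_le x (r r' : RR) : r <= r' -> Ball x r `<=` Ball x r'.
Proof. by move=> rr t h k; apply: (le_trans (h k)); rewrite lee_fin. Qed.

(** [H] collects the [t] for which [Z n t] is near a heavy centre for infinitely many [n]. As ball
    masses decrease with the level, infinitely many levels bound all of them from below. *)
Lemma uniform_mass (r k : RR) : 0 < r -> 0 < k ->
  exists (dl : RR) (H : set cantor), [/\ 0 < dl, measurable H, ((1 - k)%:E <= Q H)%E &
    forall t, H t -> (dl%:E <= Q (Ball (Z^~ t) r))%E].
Proof.
(* Half of [k] pays for the net and half for the light balls; the bound 1/2 gives [k' < 1], as [cov]
   demands. With half the radius, the ball around a centre near [Z n t] stays inside the ball of
   radius [r] around [Z n t]. *)
move=> r0 k0; pose k' := Num.min (k / 2) (1 / 2); pose r' := r / 2.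
have k'0 : 0 < k' by rewrite lt_min; apply/andP; split; lra.
have k'1 : k' < 1 by rewrite gt_min; apply/orP; right; lra.
have k'k : k' <= k / 2 by rewrite ge_min lexx.
have r'0 : 0 < r' by rewrite /r'; lra.
have [K KP] := cov r'0 k'0 k'1.
(* At most [K] light balls then cost at most [k']; the successor avoids division by zero. *)
pose dl := k' / K.+1%:R.
have dl0 : 0 < dl by rewrite divr_gt0.
pose N n := projT1 (cid (KP n)).
have NP n : (size (N n) <= K)%N /\ ((1 - k')%:E <= emm_mu (Bnbhd r' (N n)))%E.
  by rewrite /N; case: cid.
pose G n := Bnbhd r' [seq y <- N n | dl%:E <= emm_mu (cball y r')]%E.
have mG n : measurable (G n) by exact: measurable_Bnbhd.
have GP n : ((1 - k)%:E <= emm_mu (G n))%E.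
  have [sN NN] := NP n.
  have := le_trans NN (Bnbhd_filter_measure r' (N n) (ltW dl0)).
  rewrite -/(G n) -[emm_mu _]fineK ?fin_num_measure// -EFinD !lee_fin.
  have : (size (N n))%:R * dl <= k'.
    rewrite /dl mulrA ler_pdivrMr// mulrC ler_pM2l// ler_nat.
    exact: leq_trans sN (leqnSn _).
  lra.
pose F m := [set t | exists n, (m <= n)%N /\ G n (Z n t)].
have mF m : measurable (F m).
  apply: measurable_exists => n; apply: measurable_and; first exact: measurable_const.
  exact: (measurable_preimage (@mZ n) (mG n)).
exists dl, (\bigcap_m F m); split => //.
- exact: bigcapT_measurable.
- apply: measure_bigcap_ge => // [n m nm t [i [mi Gi]]|m].
    by exists i; split => //; exact: leq_trans mi.
  apply: (le_trans (GP m)); rewrite -lZ//.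
  apply: le_measure; rewrite ?inE//; first exact: (measurable_preimage (@mZ m) (mG m)).
  by move=> t Gt; exists m.
- move=> t Ft; apply: Ball_ge => // n; have [m [nm [y [yN ty]]]] := Ft n I.
  apply: (le_trans _ (compatible_cball r (@cZ t) nm)).
  have : (dl%:E <= emm_mu (cball y r'))%E.
    by move/List.filter_In: yN => [].
  move=> /le_trans; apply; apply: le_measure; rewrite ?inE; try exact: measurable_cball.
  move=> z yz; rewrite /cball /= [r](_ : _ = r' + r'); last by rewrite /r'; lra.
  exact: emm_tri ty yz.
Qed.

End inverse_limit.

Section limit_space.
Variables (X : nat -> emmspace) (f : forall k, emm_T (X k.+1) -> emm_T (X k)).
Hypotheses (fl : forall k, lip (@f k)) (fm : forall k, mpres (@f k)).
Hypothesis cov : forall r k : RR, 0 < r -> 0 < k -> k < 1 ->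
  exists K : nat, forall n, exists N : seq (emm_T (X n)),
    (size N <= K)%N /\ ((1 - k)%:E <= emm_mu (Bnbhd r N))%E.
Variables (Q : probability cantor RR) (Z : forall k, cantor -> emm_T (X k)).
Hypotheses (mZ : forall k, measurable_fun setT (Z k))
  (lZ : forall k A, measurable A -> Q (Z k @^-1` A) = emm_mu A)
  (cZ : forall t, compatible f (Z^~ t)).

Local Notation Ball := (Ball Z).

(** A packing argument: points that are more than [2r] apart have disjoint balls of mass at least
    [dl], so there are at most $1/dl$ of them. Without a finite net such a packing could be enlarged
    forever. *)
Lemma finite_net (A : set cantor) (r dl : RR) : 0 < dl ->
  (forall t, A t -> (dl%:E <= Q (Ball (Z^~ t) r))%E) ->
  exists N : seq cantor, (forall u, List.In u N -> A u) /\
    forall t, A t -> exists2 u, List.In u N & Ball (Z^~ t) (r + r) u.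
Proof.
move=> dl0 h; apply: contrapT => nofin.
pose BU N : set cantor := [set s | exists u, List.In u N /\ Ball (Z^~ u) r s].
have mBU N : measurable (BU N).
  elim: N => [|u N IH].
    by rewrite (_ : BU _ = set0); [exact: measurable0|rewrite -subset0 => s [u []]].
  rewrite (_ : BU _ = Ball (Z^~ u) r `|` BU N).
    by apply: measurableU => //; exact: measurable_Ball.
  apply/seteqP; split => [s [v [/= [<-|vN] vs]]|s [us|[v [vN vs]]]].
  - by left.
  - by right; exists v.
  - by exists u; split => //; left.
  - by exists v; split => //; right.
have ext n : exists N : seq cantor, (forall u, List.In u N -> A u) /\
    ((n%:R * dl)%:E <= Q (BU N))%E.
  elim: n => [|n [N [NA QN]]]; first by exists [::]; split => //; rewrite mul0r measure_ge0.
  have [t At far] : exists2 t, A t & forall u, List.In u N -> ~ Ball (Z^~ t) (r + r) u.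
    apply: contrapT => H; apply: nofin; exists N; split => // t At.
    apply: contrapT => H'; apply: H; exists t => // u uN tu; apply: H'.
    by exists u.
  exists (t :: N); split => [u /= [<-//|]|]; first exact: NA.
  have mB := measurable_Ball mZ (Z^~ t) r.
  have -> : BU (t :: N) = Ball (Z^~ t) r `|` BU N.
    apply/seteqP; split => [s [v [/= [<-|vN] vs]]|s [us|[v [vN vs]]]].
    - by left.
    - by right; exists v.
    - by exists t; split => //; left.
    - by exists v; split => //; right.
  have disj : Ball (Z^~ t) r `&` BU N = set0.
    rewrite -subset0 => s [ts [u [uN us]]]; apply: (far u uN) => k.
    exact: emm_tri (ts k) (emm_d_symle (us k)).
  have -> : Q (Ball (Z^~ t) r `|` BU N) = (Q (Ball (Z^~ t) r) + Q (BU N))%E.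
    exact: measureU.
  by rewrite -add1n natrD mulrDl mul1r EFinD; apply: leeD => //; exact: h.
have [n ndl] : exists n : nat, 1 < n%:R * dl.
  exists (Num.bound (dl^-1)); rewrite -ltr_pdivrMr// mul1r.
  by apply: archi_boundP; rewrite invr_ge0 ltW.
have [N [_]] := ext n; apply/negP; rewrite -ltNge.
by apply: (le_lt_trans (probability_le1 _ (mBU N))); rewrite lte_fin.
Qed.

Definition supported (x : forall k, emm_T (X k)) :=
  compatible f x /\ forall r : RR, 0 < r -> (0 < Q (Ball x r))%E.

Lemma support_full : exists Om : set cantor,
  [/\ measurable Om, Q Om = 1%E, forall t, Om t -> supported (Z^~ t) &
    exists N : nat -> nat -> seq cantor, (forall j i u, List.In u (N j i) -> Om u) /\
      forall x (e : RR), supported x -> 0 < e ->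
        exists j i, exists2 u, List.In u (N j i) & Ball x e u].
Proof.
have [dl [H HP]] : exists (dl : nat -> nat -> RR) (H : nat -> nat -> set cantor),
   forall j i, [/\ 0 < dl j i, measurable (H j i), ((1 - rad i)%:E <= Q (H j i))%E &
    forall t, H j i t -> ((dl j i)%:E <= Q (Ball (Z^~ t) (rad j)))%E].
  pose p j i := cid (uniform_mass fl fm cov mZ lZ cZ (rad_gt0 j) (rad_gt0 i)).
  exists (fun j i => projT1 (p j i)), (fun j i => projT1 (cid (projT2 (p j i)))).
  by move=> j i; case: cid.
have mH j i : measurable (H j i) by have [] := HP j i.
(* At every radius [rad j] a point of [Om] has a ball of positive mass; for fixed [j], the sets
   [H j i] miss at most mass [rad i]. *)
pose Om := \bigcap_j \bigcup_i H j i.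
have mU j : measurable (\bigcup_i H j i) by exact: bigcupT_measurable.
have mOm : measurable Om by exact: bigcapT_measurable.
have QOm : Q Om = 1%E.
  apply: probability_bigcap1 => // j; apply/eqP; rewrite eq_le probability_le1//=.
  apply/lee_addgt0Pr => e e0; have [i ie] := invS_lt e0.
  have [_ _ h _] := HP j i.
  have h2 : (Q (H j i) <= Q (\bigcup_i H j i))%E.
    by apply: le_measure; rewrite ?inE//; exact: bigcup_sup.
  have := le_trans h h2; rewrite -[Q _]fineK ?fin_num_measure// -EFinD !lee_fin.
  by move: ie; rewrite -/(rad i); lra.
have Osupp t : Om t -> supported (Z^~ t).
  move=> Ot; split => // r r0; have [j jr] := invS_lt r0; have [i _ Hji] := Ot j I.
  have [d0 _ _ /(_ _ Hji) h] := HP j i.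
  apply: (@lt_le_trans _ _ (dl j i)%:E); first by rewrite lte_fin.
  apply: (le_trans h); apply: le_measure; rewrite ?inE; try exact: measurable_Ball.
  by apply: Ball_le; exact: ltW.
exists Om; split => //.
have netE j i : exists N : seq cantor, (forall u, List.In u N -> (H j i `&` Om) u) /\
    forall t, (H j i `&` Om) t -> exists2 u, List.In u N & Ball (Z^~ t) (rad j + rad j) u.
  have [d0 _ _ h] := HP j i; apply: (finite_net d0) => t [Ht _]; exact: h.
exists (fun j i => projT1 (cid (netE j i))); split => [j i u|x e [cx xs] e0].
  by case: cid => N [NO _] /= /NO[].
have [|j je] := @invS_lt (e / 3); first by lra.
have mB := measurable_Ball mZ x (rad j).
have := xs _ (rad_gt0 j); rewrite -[Q _]fineK ?fin_num_measure// lte_fin.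
(* [i] is chosen so that the ball of [x] is heavier than the complement of [H j i] and must meet it.
   The countable nets are therefore dense among all supported sequences, not only in [Om]. *)
move=> /invS_lt[i]; rewrite -/(rad i) => ie.
have [_ _ hH _] := HP j i.
have [t [xt HOt]] : Ball x (rad j) `&` (H j i `&` Om) !=set0.
  apply/set0P/negP => /eqP E0.
  have hHO : ((1 - rad i)%:E <= Q (H j i `&` Om))%E.
    rewrite (_ : Q _ = Q (H j i))//; apply: (probability_eq_on _ (mH j i) mOm QOm).
      exact: measurableI.
    by move=> t Ot; split => [[]|].
  have mHO : measurable (H j i `&` Om) by exact: measurableI.
  have := @measure_le_off _ _ _ Q _ set0 _ _ mB measurable0 mHO hHO.
  rewrite E0 measure0 add0e => /(_ (@subset_refl _ _)).
  by rewrite -[Q _]fineK ?fin_num_measure// lee_fin; move: ie; lra.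
exists j, i; case: cid => N [_ NP] /=; have [u uN tu] := NP t HOt.
exists u => // k; apply: (le_trans (emm_tri (xt k) (tu k))); rewrite lee_fin.
by move: je; rewrite -/(rad j); lra.
Qed.

Lemma limit_exists_aux : exists Y (pr : forall k, emm_T Y -> emm_T (X k)),
  is_limit f pr.
Proof.
have [Om [mOm QOm Osupp [N [NO NP]]]] := support_full.
have [t0 Ot0] : Om !=set0.
  by apply/set0P/negP => /eqP O0; move: QOm; rewrite O0 measure0 => /esym/eqP; rewrite onee_eq0.
pose T := {x | supported x}.
(* Off the full-measure set [Om] the sequence may fail to be supported, so a fixed supported one is
   used there. *)
pose pt t : T := if pselect (Om t) is left h then exist _ (Z^~ t) (Osupp t h)
  else exist _ (Z^~ t0) (Osupp t0 Ot0).
have ptE t k : Om t -> proj1_sig (pt t) k = Z k t by rewrite /pt; case: pselect.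
pose dd (x y : T) : \bar RR := ereal_sup (range (fun k => emm_d (proj1_sig x k) (proj1_sig y k))).
have ddP x y a : (dd x y <= a)%E <-> forall k, (emm_d (proj1_sig x k) (proj1_sig y k) <= a)%E.
  split=> [h k|h]; last by apply: ge_ereal_sup => _ [k _ <-].
  by apply: le_trans h; apply: ereal_sup_ubound; exists k.
have dd_le (x y : T) k : (emm_d (proj1_sig x k) (proj1_sig y k) <= dd x y)%E.
  exact: (iffLR (ddP _ _ _)).
have dd_ge0 x y : (0 <= dd x y)%E by apply: le_trans (dd_le _ _ 0%N); exact: emm_d_ge0.
have dd_eq0 x y : dd x y = 0%E <-> x = y.
  split=> [E|->]; last first.
    by apply/eqP; rewrite eq_le dd_ge0 andbT; apply/ddP => k; rewrite emm_dxx.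
  case: x y E => x xs [y ys] E; apply: eq_exist; apply: functional_extensionality_dep => k.
  apply/emm_d_eq0/eqP; rewrite eq_le emm_d_ge0 andbT -E.
  exact: (dd_le (exist _ x xs) (exist _ y ys)).
have dd_sym x y : dd x y = dd y x.
  by apply/eqP; rewrite eq_le; apply/andP; split; apply/ddP => k; rewrite emm_d_sym.
have dd_tri x y z : (dd x z <= dd x y + dd y z)%E.
  apply/ddP => k; apply: (le_trans (emm_d_triangle _ (proj1_sig y k) _)).
  by apply: leeD; exact: dd_le.
have dd_complete (u : nat -> T) :
    (forall e : RR, 0 < e -> exists N : nat, forall m n : nat,
       (N <= m)%N -> (N <= n)%N -> (dd (u m) (u n) <= e%:E)%E) ->
    exists l, forall e : RR, 0 < e ->
      exists N : nat, forall n : nat, (N <= n)%N -> (dd (u n) l <= e%:E)%E.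
  move=> cu.
  have limE k : exists l, forall e : RR, 0 < e ->
      exists N : nat, forall n : nat, (N <= n)%N -> (emm_d (proj1_sig (u n) k) l <= e%:E)%E.
    apply: emm_completeP => e /cu[M MP]; exists M => m n Mm Mn.
    exact: le_trans (dd_le _ _ k) (MP _ _ Mm Mn).
  pose l k := proj1_sig (cid (limE k)).
  have lP k (e : RR) : 0 < e -> exists N : nat, forall n : nat, (N <= n)%N ->
     (emm_d (proj1_sig (u n) k) (l k) <= e%:E)%E by rewrite /l; case: cid => x; exact.
  (* The levelwise limits are uniform in [k]: the auxiliary index [M'] depends on [k], but the rank
     [M] does not. Uniformity also keeps the limit in the support. *)
  have unif (e : RR) : 0 < e -> exists N : nat, forall n : nat, (N <= n)%N ->
      forall k, (emm_d (proj1_sig (u n) k) (l k) <= e%:E)%E.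
    move=> e0; have [|M MP] := cu (e / 2); first by lra.
    exists M => n Mn k; have [|M' MP'] := lP k (e / 2); first by lra.
    have h1 := le_trans (dd_le _ _ k) (MP n (maxn M M') Mn (leq_maxl _ _)).
    have h2 := MP' (maxn M M') (leq_maxr _ _).
    by apply: (le_trans (emm_tri h1 h2)); rewrite lee_fin; lra.
  have ls : supported l.
    split=> [k|r r0].
      apply: emm_eq => e e0; have [|M MP] := unif (e / 2); first by lra.
      have hM := MP M (leqnn _).
      have := le_trans (fl _ _) (hM k.+1); rewrite (proj1 (proj2_sig (u M))).
      move=> /emm_d_symle/emm_tri/(_ (hM k))/le_trans; apply.
      by rewrite lee_fin; lra.
    have [|M MP] := unif (r / 2); first by lra.
    have r20 : 0 < r / 2 by lra.
    apply: (lt_le_trans (proj2 (proj2_sig (u M)) _ r20)).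
    apply: le_measure; rewrite ?inE; try exact: measurable_Ball.
    move=> t h k; apply: (le_trans (emm_tri (emm_d_symle (MP M (leqnn _) k)) (h k))).
    by rewrite lee_fin; lra.
  exists (exist _ l ls) => e /unif[M MP]; exists M => n /MP h; exact/ddP.
have dd_separable : exists s : nat -> T, forall x (e : RR), 0 < e ->
     exists n, (dd x (s n) <= e%:E)%E.
  pose dec m : nat * nat * nat := odflt (0, 0, 0)%N (unpickle m).
  exists (fun m => pt (nth t0 (N (dec m).1.1 (dec m).1.2) (dec m).2)) => x e e0.
  have [j [i [u uN xu]]] := NP _ e (proj2_sig x) e0.
  have [l lu] : exists l, nth t0 (N j i) l = u.
    elim: (N j i) uN => //= a s IH [<-|/IH[l lsu]]; first by exists 0%N.
    by exists l.+1.
  exists (pickle (j, i, l)); rewrite /dec pickleK /= lu.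
  by apply/ddP => k; rewrite ptE//; apply: NO uN.
have mq x (r : RR) : measurable (pt @^-1` [set y | (dd x y <= r%:E)%E]).
  rewrite (_ : _ @^-1` _ = [set t | (Om t -> Ball (proj1_sig x) r t) /\
     (~ Om t -> Ball (proj1_sig x) r t0)]); last first.
    apply/seteqP; split => t; rewrite /preimage /= ddP /pt; case: pselect => o.
    - by move=> h; split.
    - by move=> h; split.
    - by move=> [h _]; exact: h.
    - by move=> [_ h]; exact: h.
  apply: measurable_and; apply: measurable_impl => //.
  - exact: measurable_Ball.
  - exact: measurable_not.
  - exact: measurable_const.
have [Y [i [j [ij ji dE mi muE]]]] :=
  emm_build (pt t0) dd_ge0 dd_eq0 dd_sym dd_tri dd_complete dd_separable Q mq.
exists Y, (fun k y => proj1_sig (j y) k).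
have dP y y' (a : \bar RR) : (emm_d y y' <= a)%E <->
    forall k, (emm_d (proj1_sig (j y) k) (proj1_sig (j y') k) <= a)%E.
  by rewrite -ddP -dE !ji.
have prl k : lip (fun y => proj1_sig (j y) k) by move=> y y'; exact: (iffLR (dP _ _ _)).
split => //.
- apply/full_supportP => y e e0; rewrite muE.
  have mB := measurable_Ball mZ (proj1_sig (j y)) e.
  apply: (lt_le_trans (proj2 (proj2_sig (j y)) _ e0)).
  have -> : Q (Ball (proj1_sig (j y)) e) = Q (Ball (proj1_sig (j y)) e `&` Om).
    apply: (probability_eq_on _ _ mOm QOm) => //; first exact: measurableI.
    by move=> t Ot; split => [|[]].
  apply: le_measure; rewrite ?inE; first exact: measurableI.
    exact: (measurable_preimage mi (measurable_cball _ _)).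
  by move=> t [yt Ot]; apply/dP => k; rewrite /= ij ptE.
- move=> k A mA; rewrite muE -(@lZ k)//.
  apply: (probability_eq_on _ _ mOm QOm) => //.
  + exact: (measurable_preimage (@mZ k)).
  + apply: (measurable_preimage mi); exact: (measurable_preimage (lip_measurable (prl k))).
  + by move=> t Ot; rewrite /preimage /= ij ptE.
- by move=> y k; exact: (proj1 (proj2_sig (j y))).
- move=> x cx h.
  have xs : supported x.
    split => // r /h[c c0 cP]; apply: (lt_le_trans c0).
    exact: (Ball_ge fl mZ lZ cZ).
  by exists (i (exist _ x xs)) => k; rewrite ij.
Qed.

End limit_space.

(** * Universal property of the inverse limit *)

Section limits.
Variables (X : nat -> emmspace) (f : forall k, emm_T (X k.+1) -> emm_T (X k)).
Hypotheses (fl : forall k, lip (@f k)) (fm : forall k, mpres (@f k)).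

Lemma limit_exists :
  (forall r k : RR, 0 < r -> 0 < k -> k < 1 ->
     exists K : nat, forall n, exists N : seq (emm_T (X n)),
       (size N <= K)%N /\ ((1 - k)%:E <= emm_mu (Bnbhd r N))%E) ->
  exists Y (pr : forall k, emm_T Y -> emm_T (X k)), is_limit f pr.
Proof.
move=> cov; have [Q [Z [mZ lZ cZ]]] := realization_exists fl fm.
by apply: (limit_exists_aux fl fm cov mZ lZ) => t k; exact: cZ.
Qed.

Lemma compatible_factor k k' : (k <= k')%N ->
  exists F : emm_T (X k') -> emm_T (X k), lip F /\
    forall x, compatible f x -> x k = F (x k').
Proof.
elim: k' => [|k' IH]; first by rewrite leqn0 => /eqP ->; exists id; split => // x y; exact: lexx.
rewrite leq_eqVlt => /orP[/eqP ->|/IH[F [Fl FE]]].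
  by exists id; split => // x y; exact: lexx.
exists (F \o @f k'); split => [|x cx]; first exact: lip_comp.
by rewrite /= cx FE.
Qed.

Variables (Y : emmspace) (pr : forall k, emm_T Y -> emm_T (X k)).
Hypothesis lim : is_limit f pr.

Lemma limit_lip k : lip (pr k).
Proof. by move=> y y'; have [_ _ _ /(_ y y' (emm_d y y'))[+ _] _] := lim; apply. Qed.

(** The limit is separable, so open sets are countable unions of closed balls, and each closed ball
    is a countable intersection of cylinders. Measures on the limit can thus be compared level by
    level. *)
Lemma limit_cylinders : @measurable _ (emm_T Y) =
  <<s [set A | exists k (B : set (emm_T (X k))), measurable B /\ A = pr k @^-1` B] >>.
Proof.
set G := [set A | _].
have [_ _ _ dP _] := lim.
apply/seteqP; split; last first.
  apply: smallest_sub; first split.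
  - exact: measurable0.
  - by move=> A mA; rewrite setTD; exact: measurableC.
  - exact: bigcupT_measurable.
  move=> _ [k [B [mB ->]]].
  exact: (measurable_preimage (lip_measurable (@limit_lip k))).
rewrite emm_borel; apply: smallest_sub; first exact: smallest_sigma_algebra.
move=> U oU; have [|c [r [A ->]]] := @mopen_bigcup_cball Y U.
  by move=> x /oU [e [/R0ltE e0 h]]; exists e.
suff : measurable (\bigcup_(i in A) cball (c i) (r i) : set (g_sigma_algebraType G)) by [].
apply: bigcup_measurable => i _.
rewrite (_ : cball _ _ = \bigcap_k (pr k @^-1` cball (pr k (c i)) (r i))).
  apply: bigcapT_measurable => k; apply: sub_sigma_algebra.
  by exists k, (cball (pr k (c i)) (r i)); split => //; exact: measurable_cball.
apply/seteqP; split => y; first by move=> /dP h k _; exact: h.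
by move=> h; apply/dP => k; exact: h.
Qed.

(** The mass of the ball around [w] bounds from below the masses of the balls around all [h k w], so
    this sequence is a point of [Y]. Preservation of the measure is checked on cylinders, which are
    closed under intersection because two levels are always comparable. *)
Lemma limit_universal W (h : forall k, emm_T W -> emm_T (X k)) : full_support W ->
  (forall k, lip (h k)) -> (forall k, mpres (h k)) ->
  (forall w, compatible f (h^~ w)) ->
  exists g : emm_T W -> emm_T Y, lip g /\ mpres g.
Proof.
move=> /full_supportP Ws hl hm hc; have [_ prm prc dP prx] := lim.
have gE w : exists y, forall k, pr k y = h k w.
  apply: prx => // r r0; exists (emm_mu (cball w r)); first exact: Ws.
  move=> k; rewrite [leRHS](hm k); last exact: measurable_cball.
  apply: le_measure; rewrite ?inE; first exact: measurable_cball.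
    exact: (measurable_preimage (lip_measurable (hl k)) (measurable_cball _ _)).
  by move=> w' ww'; exact: le_trans (hl _ _ _) ww'.
have [g gP] := choice gE; exists g.
have gl : lip g by move=> w w'; apply/dP => k; rewrite !gP; exact: hl.
split => //; have [Q QE] := law_exists (@emm_mu W) (lip_measurable gl).
suff H : forall A : set (emm_T Y), measurable A -> emm_mu A = Q A.
  by move=> A /H ->.
apply: (probability_unique limit_cylinders).
  have aux k k' (B : set (emm_T (X k))) (B' : set (emm_T (X k'))) : (k <= k')%N ->
      measurable B -> measurable B' -> exists B'' : set (emm_T (X k')), measurable B'' /\
      pr k @^-1` B `&` pr k' @^-1` B' = pr k' @^-1` B''.
    move=> kk' mB mB'; have [F [Fl FE]] := compatible_factor kk'.
    exists (F @^-1` B `&` B'); split.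
      apply: measurableI => //; exact: (measurable_preimage (lip_measurable Fl)).
    by apply/seteqP; split => y; rewrite /preimage /= (FE _ (prc y)).
  move=> _ _ [k [B [mB ->]]] [k' [B' [mB' ->]]].
  have [kk'|/ltnW kk'] := leqP k k'.
    by have [B'' [mB'' ->]] := aux _ _ _ _ kk' mB mB'; exists k', B''.
  by rewrite setIC; have [B'' [mB'' ->]] := aux _ _ _ _ kk' mB' mB; exists k, B''.
move=> _ [k [B [mB ->]]]; rewrite -(prm k)// QE (hm k)//.
by congr (_ _); apply/seteqP; split => w; rewrite /preimage /= gP.
Qed.

End limits.

(** Separability makes the distance measurable for the product sigma-algebra: $d(x,y)<r$ is
    witnessed by a dense point very close to [x]. *)
Lemma measurable_dist X : measurable_fun setT
  (fun p : emm_T X * emm_T X => emm_d p.1 p.2).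
Proof.
apply: (measurability _ (ErealGenInftyO.measurableE RR)) => _ [_ [r ->] <-]; rewrite setTI.
have [s sP] := emm_separableP X.
rewrite (_ : _ @^-1` _ = [set p | exists i, exists n, cball (s i) (rad n) p.1 /\
    (emm_d (s i) p.2 < (r - rad n)%:E)%E]); last first.
  apply/seteqP; split => [[x y]|[x y]]; rewrite /preimage /= in_itv /=.
    move=> xy; have [a a0 E] := emm_d_fin (lt_trans xy (ltry r)).
    move: xy; rewrite E lte_fin => ar.
    have [|n na] := @invS_lt ((r - a) / 2); first by lra.
    have [i /ltW/emm_d_symle xi] := sP x _ (rad_gt0 n).
    exists i, n; split => //.
    have : (emm_d x y <= a%:E)%E by rewrite E.
    move=> /(emm_tri xi)/le_lt_trans; apply.
    by move: na; rewrite -/(rad n) lte_fin; lra.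
  move=> [i [n [/emm_d_symle ix iy]]].
  by apply: (lt_le_trans (emm_tri_lt ix iy)); rewrite lee_fin; lra.
apply: measurable_exists => i; apply: measurable_exists => n; apply: measurable_and.
  exact: (measurable_preimage measurable_fst (measurable_cball (s i) (rad n))).
exact: (measurable_preimage measurable_snd (measurable_ball (s i) (r - rad n))).
Qed.

(** * Energies *)

Section energy.
Implicit Types X Y W : emmspace.

Definition cutdist (q : nat) X (p : emm_T X * emm_T X) : \bar RR :=
  mine (emm_d p.1 p.2) q%:R%:E.

Definition energy (q : nat) X : \bar RR :=
  (\int[emm_mu \x emm_mu]_p @cutdist q X p)%E.

Lemma cutdist_ge0 q X p : (0 <= @cutdist q X p)%E.
Proof. by rewrite le_min emm_d_ge0 lee_fin ler0n. Qed.

Lemma cutdist_le q X p : (@cutdist q X p <= q%:R%:E)%E.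
Proof. by rewrite ge_min lexx orbT. Qed.

Lemma measurable_cutdist q X : measurable_fun setT (@cutdist q X).
Proof. by apply: measurable_mine; [exact: measurable_dist|exact: measurable_cst]. Qed.

Lemma mpres_integral X W (g : emm_T W -> emm_T X) (F : emm_T X -> \bar RR) :
  measurable_fun setT g -> mpres g -> measurable_fun setT F -> (forall x, 0 <= F x)%E ->
  (\int[emm_mu]_x F x = \int[emm_mu]_w F (g w))%E.
Proof.
move=> mg gm mF F0.
rewrite -[RHS](@ge0_integral_pushforward _ _ _ _ _ _ mg (@emm_mu W) setT F)//.
by apply: eq_measure_integral => A mA _; exact: gm.
Qed.

Lemma measurable_pairmap X W (g : emm_T W -> emm_T X) :
  measurable_fun setT g -> measurable_fun setT (fun p => (g p.1, g p.2)).
Proof.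
move=> mg; apply/measurable_fun_pairP; split.
  exact: (measurableT_comp mg measurable_fst).
exact: (measurableT_comp mg measurable_snd).
Qed.

Lemma energy_pull q X W (g : emm_T W -> emm_T X) :
  measurable_fun setT g -> mpres g ->
  energy q X = (\int[emm_mu \x emm_mu]_p cutdist q (g p.1, g p.2))%E.
Proof.
move=> mg gm; have mc := @measurable_cutdist q X; have c0 := @cutdist_ge0 q X.
have mc' := measurableT_comp mc (measurable_pairmap mg).
rewrite /energy !fubini_tonelli1//.
rewrite (mpres_integral mg gm); last 2 first.
- exact: measurable_fun_fubini_tonelli_F.
- by move=> x; apply: integral_ge0 => y _; exact: c0.
apply: eq_integral => w _; rewrite /fubini_F.
rewrite (mpres_integral mg gm)//.
by apply: (measurableT_comp mc); exact: measurable_pair1.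
Qed.

Lemma cutdist_pull_le q X W (g : emm_T W -> emm_T X) p :
  lip g -> (cutdist q (g p.1, g p.2) <= cutdist q p)%E.
Proof. by move=> gl; rewrite /cutdist le_min !ge_min gl lexx ?orbT. Qed.

Lemma energy_dominated q X W : dominated X W -> (energy q X <= energy q W)%E.
Proof.
move=> /dominatedP[g [gl gm]]; have mg := lip_measurable gl.
rewrite (energy_pull q mg gm); apply: ge0_le_integral => //.
- by move=> p _; exact: cutdist_ge0.
- exact: (measurableT_comp (@measurable_cutdist q X) (measurable_pairmap mg)).
- exact: measurable_cutdist.
- by move=> p _; exact: cutdist_pull_le.
Qed.

Lemma energy_le q X : (energy q X <= q%:R%:E)%E.
Proof.
apply: (@le_trans _ _ (\int[emm_mu \x emm_mu]_(p in [set: emm_T X * emm_T X]) cst q%:R%:E p)%E).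
  apply: ge0_le_integral => //.
  - by move=> p _; exact: cutdist_ge0.
  - exact: measurable_cutdist.
  - by move=> p _; exact: cutdist_le.
have E : (emm_mu \x emm_mu)%E [set: emm_T X * emm_T X] = 1%E.
  transitivity (emm_mu [set: emm_T X] * emm_mu [set: emm_T X])%E.
    by rewrite -setXTT; exact: product_measure1E.
  by rewrite probability_setT mule1.
by rewrite integral_cst// [X in (_ * X)%E]E mule1.
Qed.

(** Monotone convergence: pulled back to [Y], the truncated distances of the [X n] increase to that
    of [Y]. *)
Lemma energy_limit q (X : nat -> emmspace) (f : forall k, emm_T (X k.+1) -> emm_T (X k))
    Y (pr : forall k, emm_T Y -> emm_T (X k)) (M : \bar RR) :
  (forall k, lip (@f k)) -> is_limit f pr -> (forall n, energy q (X n) <= M)%E ->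
  (energy q Y <= M)%E.
Proof.
move=> fl lim H; have [_ prm prc dP _] := lim.
have mp k := lip_measurable (@limit_lip _ _ _ _ lim k).
pose D n (p : emm_T Y * emm_T Y) : \bar RR := cutdist q (pr n p.1, pr n p.2).
have mD n : measurable_fun setT (D n).
  exact: (measurableT_comp (@measurable_cutdist q (X n)) (measurable_pairmap (mp n))).
have ndD p : {homo D^~ p : n m / (n <= m)%N >-> (n <= m)%E}.
  apply/nondecreasing_seqP => n.
  by rewrite /D -(prc p.1 n) -(prc p.2 n); exact: (@cutdist_pull_le q _ _ _ (_, _) (@fl n)).
have -> : energy q Y = (\int[emm_mu \x emm_mu]_p limn (D^~ p))%E.
  apply: eq_integral => p _; have cD := ereal_nondecreasing_is_cvgn (ndD p).
  apply/eqP; rewrite eq_le; apply/andP; split; last first.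
    apply: lime_le => //; near=> n; exact: (@cutdist_pull_le q _ _ _ p (@limit_lip _ _ _ _ lim n)).
  have DL n : (D n p <= limn (D^~ p))%E.
    rewrite (cvg_lim _ (ereal_nondecreasing_cvgn (ndD p)))//.
    by apply: ereal_sup_ubound; exists n.
  rewrite /cutdist ge_min; apply/orP.
  have [qL|Lq] := leP q%:R%:E (limn (D^~ p)); [by right|left].
  apply/dP => k; have := DL k; rewrite {1}/D /cutdist ge_min /= => /orP[//|].
  by rewrite leNgt Lq.
rewrite monotone_convergence//; last by move=> n p _; exact: cutdist_ge0.
apply: lime_le.
  apply: ereal_nondecreasing_is_cvgn => n m nm; apply: ge0_le_integral => //.
  - by move=> p _; exact: cutdist_ge0.
  - by move=> p _; exact: ndD.
near=> n; rewrite -(energy_pull q (mp n) (prm n)); exact: H.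
Unshelve. all: by end_near. Qed.

(** If [h] shortens one pair, it shortens all nearby pairs by a fixed margin. By full support these
    pairs have positive measure, so some energy of [W] would exceed that of [X]. *)
Lemma energy_rigid X W (h : emm_T W -> emm_T X) : full_support W ->
  lip h -> mpres h -> (forall q, energy q W <= energy q X)%E ->
  forall w w', emm_d (h w) (h w') = emm_d w w'.
Proof.
move=> /full_supportP Ws hl hm H w w'; apply/eqP; rewrite eq_le hl /= leNgt; apply/negP => lt.
have [a a0 E] := emm_d_fin (lt_le_trans lt (leey _)); rewrite E in lt.
(* Moving both points by at most [e] leaves the distance in [W] at least [a + 3 * e] and that of the
   images at most [a + 2 * e], a gap of [e]. The cut [q] lies above [a + 3 * e] so as not to hide
   the gap. *)
have [e e0 elt] : exists2 e : RR, 0 < e & ((a + 5 * e)%:E < emm_d w w')%E.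
  case: (emm_d w w') lt => [b| |]; rewrite ?lte_fin => ab //.
    by exists ((b - a) / 6); rewrite ?lte_fin; lra.
  by exists 1 => //; rewrite ltry.
pose q := Num.bound (a + 3 * e).
have qP : a + 3 * e <= q%:R by apply/ltW/archi_boundP; lra.
pose S := cball w e `*` cball w' e.
have mc x : measurable (cball x e : set (emm_T W)) by exact: measurable_cball.
have mS : measurable S by exact: measurableX.
have mg := lip_measurable hl.
have mD := measurableT_comp (@measurable_cutdist q X) (measurable_pairmap mg).
have mI : measurable_fun setT (fun p : emm_T W * emm_T W => (e * \1_S p)%:E).
  apply/measurable_EFinP; apply: measurable_funM; first exact: measurable_cst.
  exact: measurable_indic.
have I0 p : (0 <= (e * \1_S p)%:E)%E by rewrite lee_fin mulr_ge0// ltW.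
have key : (energy q X + e%:E * (emm_mu (cball w e) * emm_mu (cball w' e)) <= energy q W)%E.
  rewrite (energy_pull q mg hm).
  rewrite (_ : (e%:E * _)%E = (\int[emm_mu \x emm_mu]_p (e * \1_S p)%:E)%E); last first.
    rewrite (@integralZl_indic _ _ _ _ setT measurableT (fun=> S) e)//; last first.
      by move=> /(lt_trans e0); rewrite ltxx.
    rewrite integral_indic// setIT; congr (_ * _)%E.
    by apply/esym; exact: product_measure1E.
  rewrite -ge0_integralD//; last by move=> p _; exact: cutdist_ge0.
  apply: ge0_le_integral => //.
  - by move=> p _; apply: adde_ge0; [exact: cutdist_ge0|exact: I0].
  - exact: emeasurable_funD.
  - exact: measurable_cutdist.
  move=> p _; rewrite indicE; case: (boolP (p \in S)) => [|_]; last first.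
    by rewrite mulr0 adde0; exact: cutdist_pull_le.
  rewrite inE => -[pw pw'] /=; rewrite mulr1.
  have h1 : (cutdist q (h p.1, h p.2) <= (a + 2 * e)%:E)%E.
    rewrite /cutdist ge_min /=; apply/orP; left.
    have hwp : (emm_d (h p.1) (h w) <= e%:E)%E by apply: le_trans (hl _ _) _; rewrite emm_d_sym.
    have hwp' : (emm_d (h w') (h p.2) <= e%:E)%E by apply: le_trans (hl _ _) _.
    have Ea : (emm_d (h w) (h w') <= a%:E)%E by rewrite E.
    apply: (le_trans (emm_tri (emm_tri hwp Ea) hwp')); rewrite lee_fin; lra.
  apply: (@le_trans _ _ (a + 3 * e)%:E).
    apply: (le_trans (leeD h1 (lexx _))); rewrite -EFinD lee_fin; lra.
  rewrite /cutdist le_min lee_fin qP andbT leNgt; apply/negP => pp.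
  move: elt; apply/negP; rewrite -leNgt.
  apply: (le_trans (emm_tri (emm_tri pw (ltW pp)) (emm_d_symle pw'))).
  by rewrite lee_fin; lra.
have eX : energy q X \is a fin_num.
  rewrite ge0_fin_numE; first by apply: (le_lt_trans (energy_le q X)); rewrite ltry.
  by apply: integral_ge0 => p _; exact: cutdist_ge0.
have := le_trans key (H q); apply/negP; rewrite -ltNge lteDl//.
by rewrite mule_gt0// ?lte_fin// mule_gt0//; exact: Ws.
Qed.

End energy.

(** Every ball of [X] has positive mass and so meets the image of [h], which is thus dense;
    completeness of [W] makes [h] onto. Its inverse is the required map. *)
Lemma isometry_dominated X W (h : emm_T W -> emm_T X) : full_support X -> mpres h ->
  (forall w w', emm_d (h w) (h w') = emm_d w w') -> dominated W X.
Proof.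
move=> /full_supportP Xs hm iso.
have hl : lip h by move=> w w'; rewrite iso lexx.
have surj x : exists w, h w = x.
  have app n : exists w, (emm_d x (h w) <= (rad n)%:E)%E.
    have := Xs x _ (rad_gt0 n); rewrite hm; last exact: measurable_cball.
    apply: contraPP => /forallNP none; rewrite (_ : _ @^-1` _ = set0) ?measure0 ?ltxx//.
    by rewrite -subset0 => w; exact: none.
  have [u uP] := choice app.
  have [e e0|w wP] := @emm_completeP W u.
    have [|j je] := @invS_lt (e / 2); first by lra.
    exists j => m n jm jn; rewrite -iso.
    apply: (le_trans (emm_tri (emm_d_symle (uP m)) (uP n))); rewrite lee_fin.
    by have := rad_le jm; have := rad_le jn; move: je; rewrite -/(rad j); lra.
  exists w; apply: emm_eq => e e0; have [|N NP] := wP (e / 2); first by lra.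
  have [|j je] := @invS_lt (e / 2); first by lra.
  have h1 := NP (maxn N j) (leq_maxl _ _); rewrite -iso in h1.
  rewrite emm_d_sym; apply: (le_trans (emm_tri (uP (maxn N j)) h1)); rewrite lee_fin.
  by have := rad_le (leq_maxr N j); move: je; rewrite -/(rad j); lra.
have [g gP] := choice surj; apply/dominatedP; exists g.
have gl : lip g by move=> x x'; rewrite -iso !gP lexx.
split => // A mA; rewrite hm; last exact: (measurable_preimage (lip_measurable gl)).
congr (_ _); apply/seteqP; split => w; rewrite /preimage /=.
- by rewrite (_ : g (h w) = w)//; apply/emm_d_eq0; rewrite -iso gP; exact/emm_d_eq0.
- by rewrite (_ : g (h w) = w)//; apply/emm_d_eq0; rewrite -iso gP; exact/emm_d_eq0.
Qed.

(** * Box approximation *)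

Lemma ereal_inf_add_ge (R : realType) (A B : set (\bar R)) (t : \bar R) :
  (forall p, A p -> 0 <= p)%E -> (forall p, B p -> 0 <= p)%E ->
  (forall p q, A p -> B q -> (t <= p + q)%E) -> (t <= ereal_inf A + ereal_inf B)%E.
Proof.
move=> A0 B0 h.
have iA : (0 <= ereal_inf A)%E by apply: le_ereal_inf_tmp => p; exact: A0.
have iB : (0 <= ereal_inf B)%E by apply: le_ereal_inf_tmp => p; exact: B0.
have [Ay|] := eqVneq (ereal_inf A) +oo%E.
  by rewrite Ay addye ?leey// -ltNye (lt_le_trans _ iB).
have [By|] := eqVneq (ereal_inf B) +oo%E.
  by rewrite By addey ?leey// -ltNye (lt_le_trans _ iA).
move=> Bfin Afin.
have {}Afin : ereal_inf A \is a fin_num by rewrite ge0_fin_numE// ltey.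
have {}Bfin : ereal_inf B \is a fin_num by rewrite ge0_fin_numE// ltey.
apply/lee_addgt0Pr => e e0; have e20 : 0 < e / 2 by lra.
have [p Ap pe] := lb_ereal_inf_adherent e20 Afin.
have [q Bq qe] := lb_ereal_inf_adherent e20 Bfin.
apply: (le_trans (h _ _ Ap Bq)); apply: (le_trans (leeD (ltW pe) (ltW qe))).
by rewrite addeACA -EFinD (_ : e / 2 + e / 2 = e)//; lra.
Qed.

(** * Metrics with shortcuts *)

Section shortcut.
Variables (X Y : emmspace).
Variables (dX : emm_T X -> emm_T X -> RR) (dY : emm_T Y -> emm_T Y -> RR).
Hypotheses (dXE : forall x x', emm_d x x' = (dX x x')%:E)
  (dYE : forall y y', emm_d y y' = (dY y y')%:E).
Variables (S : emm_T X -> emm_T Y -> Prop) (e : RR).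
Hypotheses (e0 : 0 < e) (SP : forall x y x' y', S x y -> S x' y' ->
  (emm_d y y' <= emm_d x x' + e%:E)%E).

Let dX_ge0 x x' : 0 <= dX x x'.
Proof. by rewrite -lee_fin -dXE emm_d_ge0. Qed.

Let dY_ge0 y y' : 0 <= dY y y'.
Proof. by rewrite -lee_fin -dYE emm_d_ge0. Qed.

Let dX_tri x y z : dX x z <= dX x y + dX y z.
Proof. by rewrite -lee_fin EFinD -!dXE emm_d_triangle. Qed.

Let dY_tri x y z : dY x z <= dY x y + dY y z.
Proof. by rewrite -lee_fin EFinD -!dYE emm_d_triangle. Qed.

Let dX_sym x y : dX x y = dX y x.
Proof. by apply: EFin_inj; rewrite -!dXE emm_d_sym. Qed.

Let dY_sym x y : dY x y = dY y x.
Proof. by apply: EFin_inj; rewrite -!dYE emm_d_sym. Qed.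

Let SPR x y x' y' : S x y -> S x' y' -> dY y y' <= dX x x' + e.
Proof. by move=> Sp Sp'; rewrite -lee_fin EFinD -dXE -dYE; exact: SP. Qed.

Let paths z z' : set (\bar RR) := [set v | v = (dX z z')%:E \/
  exists x y x' y', [/\ S x y, S x' y' & v = (dX z x + (dY y y' + e) + dX x' z')%:E]].

Definition shortcut z z' : \bar RR := ereal_inf (paths z z').

Let paths_ge0 z z' v : paths z z' v -> (0 <= v)%E.
Proof.
case=> [->|[x [y [x' [y' [_ _ ->]]]]]]; rewrite lee_fin//.
by have := e0; have := dX_ge0 z x; have := dX_ge0 x' z'; have := dY_ge0 y y'; lra.
Qed.

Let shortcut_le z z' : (shortcut z z' <= emm_d z z')%E.
Proof. by apply: ereal_inf_lbound; left; rewrite dXE. Qed.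

Let shortcut_ge0 z z' : (0 <= shortcut z z')%E.
Proof. by apply: le_ereal_inf_tmp => v; exact: paths_ge0. Qed.

Let shortcut_fin z z' : exists a : RR, shortcut z z' = a%:E.
Proof.
have := shortcut_le z z'; have := shortcut_ge0 z z'; rewrite dXE.
by case: (shortcut z z') => // a; exists a.
Qed.

(** Every shortcut costs at least [e], so below [e] both metrics agree. Separation of points and
    completeness are inherited from [X] in this way. *)
Let shortcut_small z z' : (shortcut z z' < e%:E)%E -> emm_d z z' = shortcut z z'.
Proof.
move=> lt; apply/eqP; rewrite eq_le shortcut_le andbT leNgt; apply/negP => lt'.
have : (mine (emm_d z z') e%:E <= shortcut z z')%E.
  apply: le_ereal_inf_tmp => v [->|[x [y [x' [y' [_ _ ->]]]]]]; rewrite ge_min.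
    by rewrite dXE lexx.
  apply/orP; right; rewrite lee_fin.
  by have := e0; have := dX_ge0 z x; have := dX_ge0 x' z'; have := dY_ge0 y y'; lra.
by rewrite ge_min => /orP[]; apply/negP; rewrite -ltNge.
Qed.

Let shortcut_eq0 z z' : shortcut z z' = 0%E <-> z = z'.
Proof.
split=> [E|->].
  by apply/emm_d_eq0; rewrite shortcut_small E// lte_fin.
by apply/eqP; rewrite eq_le shortcut_ge0 andbT -(emm_dxx z').
Qed.

Let shortcut_sym z z' : shortcut z z' = shortcut z' z.
Proof.
congr ereal_inf; apply/seteqP; split => v [->|[x [y [x' [y' [Sp Sp' ->]]]]]].
- by left; rewrite dX_sym.
- right; exists x', y', x, y; split => //; rewrite (dX_sym z) (dX_sym _ z') (dY_sym y).
  by congr EFin; lra.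
- by left; rewrite dX_sym.
- right; exists x', y', x, y; split => //; rewrite (dX_sym z') (dX_sym _ z) (dY_sym y).
  by congr EFin; lra.
Qed.

(* Two consecutive shortcuts are never shorter than a single one, by [SP]. *)
Let shortcut_tri u v w : (shortcut u w <= shortcut u v + shortcut v w)%E.
Proof.
apply: ereal_inf_add_ge; [exact: paths_ge0|exact: paths_ge0|].
have via a b : paths u w b%:E -> b <= a -> (shortcut u w <= a%:E)%E.
  by move=> pb ba; apply: (@le_trans _ _ b%:E); [exact: ereal_inf_lbound|rewrite lee_fin].
move=> _ _ [->|[x [y [x' [y' [S1 S2 ->]]]]]] [->|[x1 [y1 [x1' [y1' [S3 S4 ->]]]]]]; rewrite -EFinD.
- by apply: (via _ (dX u w)); [left|exact: dX_tri].
- apply: (via _ (dX u x1 + (dY y1 y1' + e) + dX x1' w)).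
    by right; exists x1, y1, x1', y1'.
  by have := e0; have := dX_tri u v x1; lra.
- apply: (via _ (dX u x + (dY y y' + e) + dX x' w)).
    by right; exists x, y, x', y'.
  by have := dX_tri x' v w; lra.
- apply: (via _ (dX u x + (dY y y1' + e) + dX x1' w)).
    by right; exists x, y, x1', y1'.
  have := dX_tri x' v x1; have := SPR S2 S3.
  have := e0; have := dY_tri y y' y1'; have := dY_tri y' y1 y1'; lra.
Qed.

(** On [S] the new distance is at most [dY + e] by the shortcut itself, and at least [dY - e]
    because [SP] bounds [dX] below along any path. *)
Lemma shortcut_space : full_support X -> exists (X' : emmspace) (i : emm_T X -> emm_T X'),
  [/\ mm_space X', lip i, mpres i &
      forall x y x' y', S x y -> S x' y' ->
        (emm_d (i x) (i x') <= emm_d y y' + e%:E)%E /\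
        (emm_d y y' <= emm_d (i x) (i x') + e%:E)%E].
Proof.
move=> /full_supportP Xs; have e_gt0 := e0.
have cplt (u : nat -> emm_T X) :
    (forall e : RR, 0 < e -> exists N : nat, forall m n : nat,
       (N <= m)%N -> (N <= n)%N -> (shortcut (u m) (u n) <= e%:E)%E) ->
    exists l, forall e : RR, 0 < e ->
      exists N : nat, forall n : nat, (N <= n)%N -> (shortcut (u n) l <= e%:E)%E.
  move=> cu; have [e' e'0|l lP] := @emm_completeP X u.
    have [|N NP] := cu (Num.min e' (e / 2)); first by rewrite lt_min e'0; lra.
    exists N => m n Nm Nn; have h := NP _ _ Nm Nn; rewrite shortcut_small.
      by apply: (le_trans h); rewrite lee_fin ge_min lexx.
    by apply: (le_lt_trans h); rewrite lte_fin gt_min; apply/orP; right; lra.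
  exists l => e' /lP[N NP]; exists N => n /NP; apply: le_trans; exact: shortcut_le.
have sep : exists s : nat -> emm_T X, forall x (e' : RR), 0 < e' ->
    exists n, (shortcut x (s n) <= e'%:E)%E.
  have [s sP] := emm_separableP X; exists s => x e' /(sP x)[n xn]; exists n.
  exact: le_trans (shortcut_le _ _) (ltW xn).
(* Strict balls of the smaller metric are open for the old one; a closed ball is a countable
   intersection of them. *)
have mq x (r : RR) : measurable (id @^-1` [set y | (shortcut x y <= r%:E)%E]).
  rewrite (_ : _ @^-1` _ = [set y | forall n, (shortcut x y < (r + rad n)%:E)%E]).
    apply: measurable_forall => n; apply: mopen_measurable => y /= xy.
    have [a E] := shortcut_fin x y.
    move: xy; rewrite E lte_fin => xy; exists (r + rad n - a); split; first by lra.
    move=> y' /= yy'; apply: (le_lt_trans (shortcut_tri x y y')); rewrite E.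
    have := le_lt_trans (shortcut_le y y') yy'; have [b ->] := shortcut_fin y y'.
    by rewrite -EFinD !lte_fin; lra.
  apply/seteqP; split => y; rewrite /preimage /=.
    by move=> h n; apply: (le_lt_trans h); rewrite lte_fin; have := rad_gt0 n; lra.
  move=> h; apply/lee_addgt0Pr => e' e'0; have [n ne] := invS_lt e'0.
  by apply: (le_trans (ltW (h n))); rewrite -EFinD lee_fin; move: ne; rewrite -/(rad n); lra.
have [X' [i [j [ij ji dE _ muE]]]] := emm_build (point : emm_T X) shortcut_ge0
  shortcut_eq0 shortcut_sym shortcut_tri cplt sep (@emm_mu X) mq.
have il : lip i by move=> x x'; rewrite dE.
exists X', i; split => //.
- split=> [x x'|]; first rewrite -(ji x) -(ji x') dE.
    by apply: le_lt_trans (shortcut_le _ _) _; rewrite dXE ltry.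
  apply/full_supportP => x r r0; rewrite muE; apply: (lt_le_trans (Xs (j x) r r0)).
  apply: le_measure; rewrite ?inE; first exact: measurable_cball.
    exact: (measurable_preimage (lip_measurable il) (measurable_cball _ _)).
  by move=> x' xx'; rewrite /preimage /cball /= -[x]ji; exact: le_trans (il _ _) xx'.
- move=> x y x' y' Sxy Sxy'; rewrite dE; split.
    apply: ereal_inf_lbound; right; exists x, y, x', y'; split => //.
    rewrite dYE -EFinD; congr EFin.
    have : dX x x = 0 by apply: EFin_inj; rewrite -dXE emm_dxx.
    have : dX x' x' = 0 by apply: EFin_inj; rewrite -dXE emm_dxx.
    lra.
  rewrite -leeBlDr//; apply: le_ereal_inf_tmp => v [->|[x1 [y1 [x1' [y1' [S1 S2 ->]]]]]];
    rewrite dYE -EFinB lee_fin.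
    by have := SPR Sxy Sxy'; lra.
  have := SPR Sxy S1; have := SPR S2 Sxy'.
  have := dY_tri y y1 y'; have := dY_tri y1 y1' y'; lra.
Qed.

End shortcut.

Lemma eventually_list T (N : seq T) (B : T -> nat -> Prop) :
  (forall y, exists n0, forall n, (n0 <= n)%N -> B y n) ->
  exists n0, forall n, (n0 <= n)%N -> forall y, List.In y N -> B y n.
Proof.
move=> h; elim: N => [|y N [n0 IH]]; first by exists 0%N.
have [n1 yP] := h y; exists (maxn n0 n1) => n; rewrite geq_max => /andP[n0n n1n] z /= [<-|].
  exact: yP.
exact: IH.
Qed.

Lemma In_nth T (x0 x : T) s : List.In x s <-> exists k, (k < size s)%N /\ nth x0 s k = x.
Proof.
elim: s => [|y s [IH1 IH2]] /=; first by split => // -[k []].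
split=> [[->|/IH1[k [ks E]]]|[[|k] [ks E]]].
- by exists 0%N.
- by exists k.+1.
- by left.
- by right; apply: IH2; exists k.
Qed.

Lemma emm_d_fineE X : (forall x x' : emm_T X, (emm_d x x' < +oo)%E) ->
  forall x x' : emm_T X, emm_d x x' = (fine (emm_d x x'))%:E.
Proof. by move=> fin x x'; have [a _ ->] := emm_d_fin (fin x x'). Qed.

Section box_approximation.
Variables (X : nat -> emmspace) (f : forall k, emm_T (X k.+1) -> emm_T (X k)).
Hypotheses (fl : forall k, lip (@f k)).
Hypothesis Xmm : forall k, mm_space (X k).
Variables (L : emmspace) (pr : forall k, emm_T L -> emm_T (X k)).
Hypothesis lim : is_limit f pr.

Lemma limit_dist_approx (b c : emm_T L) (a e : RR) : 0 < e -> (a%:E <= emm_d b c)%E ->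
  exists n0, forall n, (n0 <= n)%N -> (a%:E <= emm_d (pr n b) (pr n c) + e%:E)%E.
Proof.
move=> e0 abc; have [_ _ prc dP _] := lim.
have [n0 n0P] : exists n0, ((a - e)%:E < emm_d (pr n0 b) (pr n0 c))%E.
  apply: contrapT => /forallNP h; have : (emm_d b c <= (a - e)%:E)%E.
    by apply/dP => k; rewrite leNgt; apply/negP.
  by move=> /(le_trans abc); rewrite lee_fin; lra.
exists n0 => n nn; rewrite -leeBlDr// -EFinB; apply: (le_trans (ltW n0P)).
elim: n nn => [|n IH]; first by rewrite leqn0 => /eqP ->.
rewrite leq_eqVlt => /orP[/eqP ->//|/IH/le_trans]; apply.
by rewrite -(prc b n) -(prc c n); exact: fl.
Qed.

(** Both [Y] and [Y'] are images of [L], so the joint law of the two maps is a coupling. The set [D]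
    of pairs close to the images of one net point carries almost all of its mass. *)
Lemma box_approx (Y : emmspace) (e : RR) : mm_space Y -> dominated Y L -> 0 < e ->
  exists n Y', [/\ mm_space Y', dominated Y' (X n) & (box Y Y' < e%:E)%E].
Proof.
move=> [Yfin _] /dominatedP[g [gl gm]] e0; have [_ prm _ _ _] := lim.
(* The distortion of [D] is at most [5 * r]: [2 * r] in each space for replacing two points by net
   points, and [r] for the shortcut metric. The sixth [r] gives strict inequality. *)
pose r := e / 6; have r0 : 0 < r by rewrite /r; lra.
have [N NP] := emm_net L r0 r0.
have [n nP] : exists n, forall b c, List.In b N -> List.In c N ->
    (emm_d (g b) (g c) <= emm_d (pr n b) (pr n c) + r%:E)%E.
  have [|n0 nP] := @eventually_list _ N (fun b n => forall c, List.In c N ->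
      (emm_d (g b) (g c) <= emm_d (pr n b) (pr n c) + r%:E)%E).
    move=> b; apply: eventually_list => c.
    have [a a0 E] := emm_d_fin (Yfin (g b) (g c)); rewrite E.
    by apply: limit_dist_approx => //; rewrite -E.
  by exists n0 => b c bN cN; exact: (nP n0 (leqnn _) b bN c cN).
have [Xfin Xs] := Xmm n.
pose S x y := exists2 b, List.In b N & pr n b = x /\ g b = y.
have SP x y x' y' : S x y -> S x' y' -> (emm_d y y' <= emm_d x x' + r%:E)%E.
  by move=> [b bN [<- <-]] [c cN [<- <-]]; exact: nP.
have [Y' [i [Y'mm il im iS]]] := shortcut_space (emm_d_fineE Xfin) (emm_d_fineE Yfin) r0 SP Xs.
exists n, Y'; split => //; first by apply/dominatedP; exists i.
have prl := limit_lip lim.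
have mh : measurable_fun setT (fun w => (g w, i (pr n w))).
  apply/measurable_fun_pairP; split; first exact: lip_measurable.
  apply: lip_measurable; exact: (lip_comp il (@prl n)).
have [pi piE] := law_exists (@emm_mu L) mh.
pose b0 : emm_T L := point.
pose D : set (emm_T Y * emm_T Y') := [set p | exists k, (k < size N)%N /\
  (cball (g (nth b0 N k)) r p.1 /\ cball (i (pr n (nth b0 N k))) r p.2)].
have mD : measurable D.
  apply: measurable_exists => k; apply: measurable_and; first exact: measurable_const.
  apply: measurable_and.
    exact: (measurable_preimage measurable_fst (measurable_cball _ _)).
  exact: (measurable_preimage measurable_snd (measurable_cball _ _)).
have piD : ((1 - r)%:E <= pi D)%E.
  apply: (le_trans NP); rewrite piE; apply: le_measure; rewrite ?inE.
  - exact: measurable_Bnbhd.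
  - exact: (measurable_preimage mh mD).
  - move=> w [b [/(In_nth b0)[k [kN <-]] wb]]; exists k; split => //.
    split; rewrite /cball /= emm_d_sym; first exact: le_trans (gl _ _) wb.
    exact: le_trans (il _ _) (le_trans (prl _ _ _) wb).
apply: (@le_lt_trans _ _ (5 * r)%:E); last by rewrite lte_fin /r; lra.
apply: (@le_trans _ _ (maxe (dis D) (1 - pi D))%E).
  apply: ereal_inf_lbound; exists pi, D; split => //; split => [A mA|A mA]; rewrite piE.
    rewrite gm//; congr (_ _); apply/seteqP; split => w; rewrite /preimage /=; [by case|by split].
  have mp : mpres (i \o pr n) by apply: mpres_comp => //; exact: prm.
  by rewrite mp//; congr (_ _); apply/seteqP; split => w; rewrite /preimage /=; [case|split].
rewrite ge_max; apply/andP; split.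
  apply: ge_ereal_sup => _ [p [q [[k [kN [pk1 pk2]]] [[l [lN [ql1 ql2]]] ->]]]].
  have [||h1 h2] := iS (pr n (nth b0 N k)) (g (nth b0 N k)) (pr n (nth b0 N l)) (g (nth b0 N l)).
  - by exists (nth b0 N k) => //; apply/(In_nth b0); exists k.
  - by exists (nth b0 N l) => //; apply/(In_nth b0); exists l.
  move: h1 h2 => /=; set b := nth b0 N k in pk1 pk2 *; set c := nth b0 N l in ql1 ql2 *.
  have [A A0 EA] := emm_d_fin (Yfin p.1 q.1).
  have [B B0 EB] := emm_d_fin (Yfin (g b) (g c)).
  have [C C0 EC] := emm_d_fin (Y'mm.1 (i (pr n b)) (i (pr n c))).
  have [E E0 EE] := emm_d_fin (Y'mm.1 p.2 q.2).
  have hA : (emm_d p.1 q.1 <= (r + B + r)%:E)%E.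
    by apply: emm_tri ql1; apply: emm_tri; [exact: emm_d_symle pk1|rewrite EB].
  have hB : (emm_d (g b) (g c) <= (r + A + r)%:E)%E.
    by apply: emm_tri (emm_d_symle ql1); apply: emm_tri pk1 _; rewrite EA.
  have hE : (emm_d p.2 q.2 <= (r + C + r)%:E)%E.
    by apply: emm_tri ql2; apply: emm_tri; [exact: emm_d_symle pk2|rewrite EC].
  have hC : (emm_d (i (pr n b)) (i (pr n c)) <= (r + E + r)%:E)%E.
    by apply: emm_tri (emm_d_symle ql2); apply: emm_tri pk2 _; rewrite EE.
  move: hA hB hE hC; rewrite EA EB EC EE -!EFinD !lee_fin => hA hB hE hC h1 h2.
  suff : (`|A%:E - E%:E| <= (5 * r)%:E)%E by [].
  by rewrite -EFinB abse_EFin lee_fin ler_norml; apply/andP; split; lra.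
move: piD; rewrite -[pi D]fineK ?fin_num_measure// -EFinB !lee_fin; lra.
Qed.

End box_approximation.

(** * Pyramids *)

Lemma dominated_refl X : dominated X X.
Proof. by apply/dominatedP; exists id; split => // x y; exact: lexx. Qed.

Section pyramid_limits.
Variable P : emmspace -> Prop.
Hypotheses (pP : pyramid P)
  (cP : forall r k : RR, 0 < r -> 0 < k -> k < 1 -> (CovP P r k < +oo)%E).

Lemma increasing_sequence (Y : nat -> emmspace) : (forall n, P (Y n)) ->
  exists (X : nat -> emmspace) (f : forall k, emm_T (X k.+1) -> emm_T (X k)),
    [/\ forall n, P (X n), forall k, lip (@f k), forall k, mpres (@f k) &
        forall n, dominated (Y n) (X n)].
Proof.
move=> PY; have [_ [_ [_ [_ Pdir]]]] := pP.
have next n (Z : {Z | P Z}) : {Z' : {Z | P Z} |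
    dominated (sval Z) (sval Z') /\ dominated (Y n.+1) (sval Z')}.
  have [Z' [PZ' h]] := cid (Pdir _ _ (proj2_sig Z) (PY n.+1)).
  by exists (exist _ Z' PZ').
pose S := fix S n : {Z | P Z} :=
  if n is m.+1 then sval (next m (S m)) else exist _ (Y 0%N) (PY 0%N).
have dS n : dominated (sval (S n)) (sval (S n.+1)) by case: (proj2_sig (next n (S n))).
pose f k := sval (cid (iffLR (dominatedP _ _) (dS k))).
have fP k : lip (f k) /\ mpres (f k) by rewrite /f; case: cid.
exists (fun n => sval (S n)), f; split => [n|k|k|[|n]].
- exact: proj2_sig.
- by case: (fP k).
- by case: (fP k).
- exact: dominated_refl.
- by case: (proj2_sig (next n (S n))).
Qed.

Lemma pyramid_limit (Y : nat -> emmspace) : (forall n, P (Y n)) ->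
  exists (X : nat -> emmspace) (f : forall k, emm_T (X k.+1) -> emm_T (X k))
    (L : emmspace) (pr : forall k, emm_T L -> emm_T (X k)),
    [/\ (forall n, P (X n)) /\ (forall n, dominated (Y n) (X n)),
        forall k, lip (@f k), forall k, mpres (@f k) & is_limit f pr].
Proof.
move=> /increasing_sequence[X [f [PX fl fm YX]]].
have [r k r0 k0 k1|L [pr lim]] := limit_exists fl fm.
  have [K KP] := CovP_net (cP r0 k0 k1); exists K => n; exact: KP.
by exists X, f, L, pr.
Qed.

Lemma limit_dominates (X : nat -> emmspace) (f : forall k, emm_T (X k.+1) -> emm_T (X k))
    L (pr : forall k, emm_T L -> emm_T (X k)) n : is_limit f pr -> dominated (X n) L.
Proof.
move=> lim; apply/dominatedP; exists (pr n); split; first exact: (limit_lip lim).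
by case: lim.
Qed.

Let top_energy q := ereal_sup [set z | exists X, P X /\ z = energy q X].

Let energy_near q n : exists2 Y, P Y & (top_energy q <= energy q Y + (rad n)%:E)%E.
Proof.
have [_ [[X0 PX0] _]] := pP.
have fin : top_energy q \is a fin_num.
  rewrite ge0_fin_numE.
    apply: (@le_lt_trans _ _ q%:R%:E); last exact: ltry.
    by apply: ge_ereal_sup => _ [X [_ ->]]; exact: energy_le.
  apply: (@le_trans _ _ (energy q X0)); last by apply: ereal_sup_ubound; exists X0.
  by apply: integral_ge0 => p _; exact: cutdist_ge0.
have [_ [Y [PY ->]] h] := ub_ereal_sup_adherent (rad_gt0 n) fin.
by exists Y => //; rewrite -leeBlDr//; exact: ltW.
Qed.

Lemma pyramid_representable : exists X, forall Y, P Y <-> pyramid_of X Y.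
Proof.
have [Pmm [_ [Pcl [Pdown Pdir]]]] := pP.
(* The index [m] runs through all pairs of a truncation [q] and a precision [n], so that one
   sequence nearly maximises every energy. *)
pose dec m : nat * nat := odflt (0, 0)%N (unpickle m).
pose Y0 m := s2val (cid2 (energy_near (dec m).1 (dec m).2)).
have Y0P m : P (Y0 m) /\
    (top_energy (dec m).1 <= energy (dec m).1 (Y0 m) + (rad (dec m).2)%:E)%E.
  by rewrite /Y0; case: cid2.
have [X [f [L [pr [[PX YX] fl fm lim]]]]] := pyramid_limit (fun m => (Y0P m).1).
have [Ls _ _ _ _] := lim.
have topL q : (top_energy q <= energy q L)%E.
  apply/lee_addgt0Pr => e e0; have [n ne] := invS_lt e0.
  have := (Y0P (pickle (q, n))).2; rewrite /dec pickleK /= => /le_trans; apply.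
  apply: leeD; last by rewrite lee_fin; exact: ltW.
  apply: energy_dominated; apply: (dominated_trans (YX _)).
  exact: (limit_dominates _ lim).
exists L => Y; split=> [PY|[Ymm YL]]; last first.
  apply: Pcl => // e /R0ltE e0.
  have [n [Y' [Y'mm Y'X bY]]] := box_approx fl (fun k => Pmm _ (PX k)) lim Ymm YL e0.
  by exists Y'; split => //; exact: (Pdown _ _ (PX n)).
split; first exact: Pmm.
(* Each [W m] dominates both [Y] and [X m], so the limit built on this sequence lies above [Y] and
   above every term defining [L]. *)
pose W m := sval (cid (Pdir _ _ PY (PX m))).
have WP m : P (W m) /\ dominated Y (W m) /\ dominated (X m) (W m) by rewrite /W; case: cid.
have [Z [f' [L' [pr' [[PZ WZ] fl' fm' lim']]]]] := pyramid_limit (fun m => (WP m).1).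
have [L's _ _ _ _] := lim'.
have XL' n : exists g : emm_T L' -> emm_T (X n), lip g /\ mpres g.
  apply/dominatedP; have [_ [_ XW]] := WP n; apply: (dominated_trans XW).
  by apply: (dominated_trans (WZ n)); exact: (limit_dominates _ lim').
pose g n := sval (cid (XL' n)).
have gP n : lip (g n) /\ mpres (g n) by rewrite /g; case: cid.
have [h [hl hm hc]] := compatible_limit fl fm L's (fun n => (gP n).1) (fun n => (gP n).2).
have [u [ul um]] := limit_universal fl lim L's hl hm (fun w k => hc k w).
(* The energies of [L'] are limits of energies inside the pyramid, hence at most [top_energy], which
   [L] already attains. *)
have L'L : dominated L' L.
  apply: (isometry_dominated Ls um); apply: (energy_rigid L's ul um) => q.
  apply: le_trans (topL q); apply: (energy_limit fl' lim') => n.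
  by apply: ereal_sup_ubound; exists (Z n).
have [_ [YW _]] := WP 0%N; apply: (dominated_trans YW); apply: (dominated_trans (WZ 0%N)).
by apply: (dominated_trans _ L'L); exact: (limit_dominates _ lim').
Qed.

End pyramid_limits.

Theorem theorem1p6 (P : emmspace -> Prop) :
  pyramid P ->
  ((forall r kappa : RR, 0 < r -> 0 < kappa -> kappa < 1 ->
       (CovP P r kappa < +oo)%E) <->
   (exists X : emmspace, forall Y : emmspace, P Y <-> pyramid_of X Y)).
Proof.
move=> pP; split=> [cP|[X XP] r k r0 k0 _]; first exact: pyramid_representable.
by apply: (CovP_finite_of_pyramid_of (X := X)) => // Y /XP[].
Qed.
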